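(* Fix an odd prime $p$ and $\varepsilon\in(0,1)$. There is a constant $C_{p,\varepsilon}<\infty$ such that the following holds. Let $h=2m\ge2$ and suppose $h\le\varepsilon r$. For all sufficiently large $r$, the half-lazy PA-PRA walk $Q$ on $V_r(\mathsf H)$ (with $\mathsf H=\mathsf H(W)$, $\dim W=h$) satisfies \[ \tau_{\mathrm{mix}}(Q)\le C_{p,\varepsilon}\, r(h+\log r)\log r. \] In particular, if $h\ge\log r$, then $\tau_{\mathrm{mix}}(Q)\le C_{p,\varepsilon}\,rh\log r$.
   Context: Let $p$ be an odd prime, $W$ a vector space of dimension $h=2m$ over $\mathbb F_p$ with a nondegenerate alternating bilinear form $\omega$. The Heisenberg group $\mathsf H=W\times\mathbb F_p$ has multiplication $(v,z)(w,t)=(v+w,\,z+t+\tfrac12\omega(v,w))$, where $\tfrac12$ is the inverse of $2$ in $\mathbb F_p$. Let $V_r(\mathsf H)=\{(g_1,\dots,g_r)\in\mathsf H^r:\langle g_1,\dots,g_r\rangle=\mathsf H\}$ and $\pi$ the uniform measure on it. For distinct $i,j\in[r]$ and $a\in\mathbb F_p$, $T^R_{j\to i,a}$ replaces $g_i$ by $g_ig_j^a$ and $T^L_{j\to i,a}$ replaces $g_i$ by $g_j^ag_i$ (other coordinates unchanged). The PA-PRA kernel is $Pf(g)=\frac1{2pr(r-1)}\sum_{i\ne j}\sum_{a\in\mathbb F_p}[f(T^R_{j\to i,a}g)+f(T^L_{j\to i,a}g)]$, and $Q=\frac12(I+P)$ is the half-lazy PA-PRA walk. $\tau_{\mathrm{mix}}(Q)=\min\{t\ge0:\max_x\|Q^t(x,\cdot)-\pi\|_{\mathrm{TV}}\le1/4\}$.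 *)

(* Defs.v *)
From HB Require Import structures.
From mathcomp Require Import all_boot all_order all_algebra.
From mathcomp Require Import all_classical all_reals all_analysis.
Set Implicit Arguments. Unset Strict Implicit. Unset Printing Implicit Defensive.
Import Order.TTheory GRing.Theory Num.Theory.
Local Open Scope ring_scope.

Section Heis.
Variables (p h : nat).

Definition form (om : 'M['F_p]_h) (v w : 'rV['F_p]_h) : 'F_p :=
  (v *m om *m w^T) 0 0.

Definition alternating_form (om : 'M['F_p]_h) : Prop :=
  (forall u v w : 'rV['F_p]_h, forall a : 'F_p,
      form om (a *: u + v) w = a * form om u w + form om v w) /\
  (forall u v w : 'rV['F_p]_h, forall a : 'F_p,
      form om u (a *: v + w) = a * form om u v + form om u w) /\
  (forall v, form om v v = 0).

Definition nondegenerate_form (om : 'M['F_p]_h) : Prop :=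
  forall v, (forall w, form om v w = 0) -> v = 0.

Definition heis := ('rV['F_p]_h * 'F_p)%type.

Definition hone : heis := (0, 0).
Definition hmul (om : 'M['F_p]_h) (x y : heis) : heis :=
  (x.1 + y.1, x.2 + y.2 + (2%:R)^-1 * form om x.1 y.1).
Definition hinv (x : heis) : heis := (- x.1, - x.2).
Definition hpow (om : 'M['F_p]_h) (g : heis) (a : 'F_p) : heis :=
  iter (nat_of_ord a) (hmul om g) hone.

Definition is_subgroupb (om : 'M['F_p]_h) (S : {set heis}) : bool :=
  [&& hone \in S,
      [forall x in S, forall y in S, hmul om x y \in S] &
      [forall x in S, hinv x \in S]].

Variable r : nat.
Definition tuples := {ffun 'I_r -> heis}.

Definition generatesb (om : 'M['F_p]_h) (g : tuples) : bool :=
  [forall S : {set heis},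
     (is_subgroupb om S && [forall i, g i \in S]) ==> (S == [set: heis])].

Definition Vr (om : 'M['F_p]_h) : {set tuples} := [set g | generatesb om g].

Definition TR (om : 'M['F_p]_h) (j i : 'I_r) (a : 'F_p) (g : tuples) : tuples :=
  [ffun k => if k == i then hmul om (g i) (hpow om (g j) a) else g k].
Definition TL (om : 'M['F_p]_h) (j i : 'I_r) (a : 'F_p) (g : tuples) : tuples :=
  [ffun k => if k == i then hmul om (hpow om (g j) a) (g i) else g k].

Variable R : realType.

Definition PAPRA (om : 'M['F_p]_h) (g y : tuples) : R :=
  ((2 * p * r * (r - 1))%N%:R)^-1 *
  \sum_(i : 'I_r) \sum_(j : 'I_r | j != i) \sum_(a : 'F_p)
     ((TR om j i a g == y)%:R + (TL om j i a g == y)%:R).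

Definition Qhl (om : 'M['F_p]_h) (g y : tuples) : R :=
  2^-1 * ((g == y)%:R + PAPRA om g y).

Fixpoint kpow (K : tuples -> tuples -> R) (t : nat) (x y : tuples) : R :=
  match t with
  | 0 => (x == y)%:R
  | t'.+1 => \sum_(z : tuples) kpow K t' x z * K z y
  end.

Definition unif (V : {set tuples}) (y : tuples) : R := (y \in V)%:R / #|V|%:R.

Definition tv (mu nu : tuples -> R) : R := 2^-1 * \sum_(y : tuples) `|mu y - nu y|.

Definition mixed_at (K : tuples -> tuples -> R) (V : {set tuples}) (t : nat) : Prop :=
  forall x, x \in V -> tv (kpow K t x) (unif V) <= 4^-1.

Definition is_mixing_time (K : tuples -> tuples -> R) (V : {set tuples}) (t : nat) : Prop :=
  mixed_at K V t /\ forall s, (s < t)%N -> ~ mixed_at K V s.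

End Heis.

(* Main.v *)
Require Import Defs.
From HB Require Import structures.
From mathcomp Require Import all_boot all_order all_algebra.
From mathcomp Require Import all_classical all_reals all_analysis.
From mathcomp Require Import ring lra zify.
Import Order.TTheory GRing.Theory Num.Theory.
Local Open Scope ring_scope.

Set Implicit Arguments. Unset Strict Implicit.

(** The uniform measure [U] on all tuples of [H] (not only generating ones) is
    reversible for the walk, and a law close to [U] and supported on generating
    tuples is close to [pi], so it suffices to make the entropy deficit
    [D] of the law with respect to [U] small.  A move averages one coordinate
    over a coset of a cyclic subgroup.  On [H], for a set of neighbours whose
    projections span [W], the deficit of a density is at most [50 p] times the
    sum of the entropy gains of left and right averaging along these
    neighbours: on [W] the averages commute and their gains tensorize; along
    the center, conjugation by [g_j] resamples the central coordinate of every
    [x] not commuting with [g_j]; the case of central [x] is reduced to the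
    previous one through a Hellinger comparison with another point of a coset.
    Averaging over cyclic blocks of [L = h + 4 l + 1] rows, [r <= 2 ^ l], and
    tensorizing over the [r] coordinates, [D] contracts by [1 - c / (r L)] as
    long as every block spans [W] with high probability.

    A block fails to span iff some functional [u] on [W] vanishes on it, and
    [X u] is itself a product replacement walk on [F_p^r] (one column).  The
    same entropy method applied to the column gives mixing in [O(r log r)]
    once its support is linear, which a Lyapunov function [x ^ |support|]
    shows; iterating [O(h + log r)] times beats the union bound over [p ^ h]
    functionals. *)

(** * Entropy and averaging operators *)

Section Entropy.
Variable R : realType.

Lemma ln_le_subr1 (x : R) : 0 < x -> ln x <= x - 1.
Proof. by move=> x0; have := expR_ge1Dx (ln x); rewrite lnK ?posrE //; lra. Qed.

(* Since [ln 0 = 0] here, [kl_term u 0] is [u * ln u] and not infinite; hence the hypotheses [v = 0 -> u = 0] below. *)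
Definition kl_term (u v : R) := u * (ln u - ln v).

Lemma kl_term0 (v : R) : kl_term 0 v = 0.
Proof. by rewrite /kl_term mul0r. Qed.

Lemma kl_termZ (c u v : R) : 0 <= c -> 0 <= u -> 0 <= v -> (v = 0 -> u = 0) ->
  kl_term (c * u) (c * v) = c * kl_term u v.
Proof.
rewrite le0r => /orP[/eqP->|c0]; first by rewrite !mul0r kl_term0.
rewrite le0r => /orP[/eqP->|u0]; first by rewrite mulr0 !kl_term0 mulr0.
rewrite le0r => /orP[/eqP-> /(_ erefl) u0'|v0 _]; first by rewrite u0' ltxx in u0.
by rewrite /kl_term !lnM ?posrE //; ring.
Qed.

(* The tangent line of [v |-> kl_term u v] at the ratio [U / V]; summing it gives the log-sum inequality. *)
Lemma kl_term_tangent (u v U V : R) : 0 <= u -> 0 <= v -> (v = 0 -> u = 0) -> 0 < U -> 0 < V ->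
  u * (ln U - ln V) + u - v * (U / V) <= kl_term u v.
Proof.
move=> u0 v0 uv U0 V0.
have UV0 : 0 < U / V by rewrite divr_gt0.
move: u0; rewrite le0r => /orP[/eqP->|u0].
  by rewrite kl_term0 !mul0r !add0r oppr_le0 mulr_ge0 // ltW.
move: v0; rewrite le0r => /orP[/eqP/uv u0'|v0]; first by rewrite u0' ltxx in u0.
have vUV0 : 0 < v * (U / V) by rewrite mulr_gt0.
have := ln_le_subr1 (divr_gt0 vUV0 u0).
rewrite ln_div ?posrE // lnM ?posrE // ln_div ?posrE //.
move=> /(ler_wpM2l (ltW u0)).
have -> : u * (v * (U / V) / u - 1) = v * (U / V) - u by field; rewrite !gt_eqF.
by rewrite /kl_term; lra.
Qed.

Lemma log_sum (I : finType) (P : pred I) (u v : I -> R) :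
  (forall i, 0 <= u i) -> (forall i, 0 <= v i) -> (forall i, v i = 0 -> u i = 0) ->
  kl_term (\sum_(i | P i) u i) (\sum_(i | P i) v i) <= \sum_(i | P i) kl_term (u i) (v i).
Proof.
move=> u0 v0 uv; set U := \sum_(i | P i) u i; set V := \sum_(i | P i) v i.
have U0 : 0 <= U by apply: sumr_ge0.
have V0 : 0 <= V by apply: sumr_ge0.
have UV : V = 0 -> U = 0.
  move=> /eqP; rewrite psumr_eq0 // => /allP V00.
  by apply: big1 => i Pi; apply: uv; have := V00 i (mem_index_enum i); rewrite Pi => /eqP.
move: U0; rewrite le0r => /orP[/eqP U0|U0].
  rewrite U0 kl_term0; apply: sumr_ge0 => i Pi.
  suff -> : u i = 0 by rewrite kl_term0.
  by apply: (psumr_eq0P _ U0).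
move: V0; rewrite le0r => /orP[/eqP/UV U0'|V0]; first by rewrite U0' ltxx in U0.
have -> : kl_term U V = \sum_(i | P i) (u i * (ln U - ln V) + u i - v i * (U / V)).
  rewrite big_split big_split /= sumrN -!mulr_suml -/U -/V /kl_term.
  have -> : V * (U / V) = U by rewrite mulrC divfK ?gt_eqF.
  by ring.
by apply: ler_sum => i _; apply: kl_term_tangent => //; apply: uv.
Qed.

(** From [ln x <= x - 1] at [x = sqrt (v / u)]. The terms [u - v] cancel once summed over functions
    of equal mass, leaving the squared Hellinger distance. *)
Lemma kl_term_hellinger (u v : R) : 0 <= u -> 0 <= v -> (v = 0 -> u = 0) ->
  (Num.sqrt u - Num.sqrt v) ^+ 2 + u - v <= kl_term u v.
Proof.
move=> u0 v0 uv.
have := sqr_sqrtr u0; have := sqr_sqrtr v0.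
have a0 := sqrtr_ge0 u; have b0 := sqrtr_ge0 v.
move: u0; rewrite le0r => /orP[/eqP->|u0].
  by rewrite sqrtr0 kl_term0 sqrrB !expr2; lra.
move: v0; rewrite le0r => /orP[/eqP/uv u0'|v0]; first by rewrite u0' ltxx in u0.
have {}a0 : 0 < Num.sqrt u by rewrite sqrtr_gt0.
have {}b0 : 0 < Num.sqrt v by rewrite sqrtr_gt0.
move: (Num.sqrt u) (Num.sqrt v) a0 b0 => a b a0 b0 <- <-.
rewrite /kl_term !lnXn //.
have := @ln_le_subr1 (b / a); rewrite divr_gt0 // => /(_ isT).
rewrite ln_div ?posrE // => /(ler_wpM2l (exprn_ge0 2 (ltW a0))).
have -> : a ^+ 2 * (b / a - 1) = a * b - a ^+ 2.
  by field; rewrite gt_eqF.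
move=> h.
have -> : a ^+ 2 * (ln a *+ 2 - ln b *+ 2) = - 2 * (a ^+ 2 * (ln b - ln a)) by ring.
have -> : (a - b) ^+ 2 + a ^+ 2 - b ^+ 2 = - 2 * (a * b - a ^+ 2) by ring.
lra.
Qed.

(** * Conditional expectations and their entropy gain *)

Section Resampling.
Variables (A X : finType).

Definition avg (alpha : A -> X -> X) (f : X -> R) : X -> R :=
  fun x => #|A|%:R^-1 * \sum_a f (alpha a x).

Definition entropy (f : X -> R) := \sum_x f x * ln (f x).

Definition gain (alpha : A -> X -> X) (f : X -> R) := entropy f - entropy (avg alpha f).

(* [alpha a x], with [a] uniform, is a draw from the class of [x] in some partition of [X]: [avg alpha] is the conditional expectation on that partition. *)
Definition resampling (alpha : A -> X -> X) : Prop :=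
  [/\ (0 < #|A|)%N,
      forall F : X -> R, \sum_x \sum_a F (alpha a x) = #|A|%:R * \sum_x F x,
      forall (f : X -> R) a x, \sum_b f (alpha b (alpha a x)) = \sum_b f (alpha b x) &
      forall x, exists a, alpha a x = x].

Variable alpha : A -> X -> X.
Hypothesis al : resampling alpha.

Let card0 : 0 < #|A|%:R :> R.
Proof. by case: al => h _ _ _; rewrite ltr0n. Qed.

Lemma avg_ge0 f : (forall x, 0 <= f x) -> forall x, 0 <= avg alpha f x.
Proof. by move=> f0 x; rewrite mulr_ge0 ?invr_ge0 ?ler0n // sumr_ge0. Qed.

Lemma avg_eq0 f : (forall x, 0 <= f x) -> forall x, avg alpha f x = 0 -> f x = 0.
Proof.
move=> f0 x /eqP; rewrite mulf_eq0 invr_eq0 gt_eqF //= psumr_eq0 // => /allP h.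
case: al => _ _ _ /(_ x)[a ax].
by have := h a (mem_index_enum a); rewrite ax => /eqP.
Qed.

Lemma sum_avg f : \sum_x avg alpha f x = \sum_x f x.
Proof. by case: al => _ h _ _; rewrite -mulr_sumr h mulKf ?gt_eqF. Qed.

Lemma avg_invariant f a x : avg alpha f (alpha a x) = avg alpha f x.
Proof. by case: al => _ _ h _; rewrite /avg h. Qed.

Lemma avg_id f x : (forall a, f (alpha a x) = f x) -> avg alpha f x = f x.
Proof.
move=> h; rewrite /avg (eq_bigr (fun=> f x)) // sumr_const -[f x *+ _]mulr_natl.
by rewrite mulKf ?gt_eqF.
Qed.

Lemma sum_mul_avg f g : (forall a x, g (alpha a x) = g x) ->
  \sum_x avg alpha f x * g x = \sum_x f x * g x.
Proof.
move=> gi; case: al => _ h _ _; apply: (mulfI (lt0r_neq0 card0)).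
rewrite -(h (fun x => f x * g x)) mulr_sumr; apply: eq_bigr => x _.
rewrite /avg mulrA mulVKf ?gt_eqF // mulr_suml.
by apply: eq_bigr => a _; rewrite gi.
Qed.

(** [ln (avg alpha f)] is constant on classes, hence has the same sum against [f] and against
    [avg alpha f]; the gain is thus the relative entropy of [f] with respect to its average. *)
Lemma gainE f : gain alpha f = \sum_x kl_term (f x) (avg alpha f x).
Proof.
rewrite /gain /entropy (@sum_mul_avg f (fun x => ln (avg alpha f x))); first by rewrite -sumrB; apply: eq_bigr => x _; rewrite /kl_term mulrBr.
by move=> a x; rewrite avg_invariant.
Qed.

Lemma gain_hellinger f : (forall x, 0 <= f x) ->
  \sum_x (Num.sqrt (f x) - Num.sqrt (avg alpha f x)) ^+ 2 <= gain alpha f.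
Proof.
move=> f0; rewrite gainE.
have -> : \sum_x (Num.sqrt (f x) - Num.sqrt (avg alpha f x)) ^+ 2 =
  \sum_x ((Num.sqrt (f x) - Num.sqrt (avg alpha f x)) ^+ 2 + f x - avg alpha f x).
  by rewrite big_split big_split /= sumrN sum_avg addrK.
apply: ler_sum => x _; apply: kl_term_hellinger => //; [exact: avg_ge0|exact: avg_eq0].
Qed.

Lemma gain_ge0 f : (forall x, 0 <= f x) -> 0 <= gain alpha f.
Proof.
by move=> f0; apply: le_trans (gain_hellinger f0); apply: sumr_ge0 => x _; rewrite sqr_ge0.
Qed.

(** The log-sum inequality on each class, then conservation of mass. *)
Lemma avg_data_processing f g : (forall x, 0 <= f x) -> (forall x, 0 <= g x) ->
  (forall x, g x = 0 -> f x = 0) ->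
  \sum_x kl_term (avg alpha f x) (avg alpha g x) <= \sum_x kl_term (f x) (g x).
Proof.
move=> f0 g0 fg; rewrite -[leRHS]sum_avg; apply: ler_sum => x _.
have ci : 0 <= (#|A|%:R : R)^-1 by rewrite invr_ge0 ler0n.
rewrite /avg kl_termZ // ?sumr_ge0 //.
  by apply: ler_wpM2l => //; apply: log_sum => // a; apply: fg.
move=> /eqP; rewrite psumr_eq0 // => /allP h; apply: big1 => a _; apply: fg.
by have := h a (mem_index_enum a) => /eqP.
Qed.

End Resampling.

(** With both gains written as relative entropies, commutation turns the claim into data processing
    for [avg alpha]. *)
Lemma gain_avg (A B X : finType) (alpha : A -> X -> X) (beta : B -> X -> X) f :
  resampling alpha -> resampling beta -> (forall x, 0 <= f x) ->
  (forall x, avg beta (avg alpha f) x = avg alpha (avg beta f) x) ->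
  gain beta (avg alpha f) <= gain beta f.
Proof.
move=> ra rb f0 com; rewrite !gainE // (eq_bigr (fun x => kl_term (avg alpha f x) (avg alpha (avg beta f) x))).
  by apply: avg_data_processing => //; [exact: avg_ge0|exact: avg_eq0].
by move=> x _; rewrite com.
Qed.

(** * Entropy deficit relative to the uniform measure *)

Definition flat (X : finType) (f : X -> R) : X -> R := fun=> (\sum_x f x) / #|X|%:R.

(** Relative entropy with respect to the constant of the same mass. The mass is not normalized,
    because this is applied to fibres of densities. *)
Definition deficit (X : finType) (f : X -> R) := entropy f - entropy (flat f).

Lemma avg_comm (A B X : finType) (alpha : A -> X -> X) (beta : B -> X -> X) f :
  (forall a b x, alpha a (beta b x) = beta b (alpha a x)) ->
  forall x, avg beta (avg alpha f) x = avg alpha (avg beta f) x.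
Proof.
move=> com x; rewrite /avg -!mulr_sumr mulrCA; congr (_ * (_ * _)).
by rewrite exchange_big; apply: eq_bigr => a _; apply: eq_bigr => b _; rewrite com.
Qed.

Lemma deficit_ge0 (X : finType) (f : X -> R) : (forall x, 0 <= f x) -> 0 <= deficit f.
Proof.
move=> f0; case: (posnP #|X|) => [X0|X0].
  by rewrite /deficit /entropy -sumrB big1 // => x; have := fintype0 x X0.
(* Drawing a uniform point whatever [x] is a resampling with a single class; its average is
   [flat f]. *)
have rs : resampling (fun y (_ : X) => y) by split => // [F|x]; [rewrite sumr_const -[_ *+ _]mulr_natl|exists x].
have := gain_ge0 rs f0; rewrite /gain; suff -> : avg (fun y (_ : X) => y) f = flat f by [].
by apply: funext => x; rewrite /avg /flat mulrC.
Qed.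

Lemma deficitE (X : finType) (f : X -> R) : deficit f = \sum_x kl_term (f x) ((\sum_y f y) / #|X|%:R).
Proof.
rewrite /deficit /entropy; under [RHS]eq_bigr do rewrite /kl_term mulrBr.
rewrite sumrB; congr (_ - _); rewrite -mulr_suml /flat -mulr_suml; congr (_ * _).
rewrite sumr_const -[_ *+ _]mulr_natr; case: (posnP #|X|) => [X0|X0].
  by rewrite X0 mulr0 big1 // => x; have := fintype0 x X0.
by rewrite divfK // pnatr_eq0 -lt0n.
Qed.

Lemma hellinger_le_deficit (X : finType) (f : X -> R) : (forall x, 0 <= f x) ->
  \sum_x (Num.sqrt (f x) - Num.sqrt ((\sum_y f y) / #|X|%:R)) ^+ 2 <= deficit f.
Proof.
move=> f0; rewrite deficitE; set m := _ / _.
case: (posnP #|X|) => [X0|X0].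
  by rewrite !big1 // => x; have := fintype0 x X0.
have -> : \sum_x (Num.sqrt (f x) - Num.sqrt m) ^+ 2 =
   \sum_x ((Num.sqrt (f x) - Num.sqrt m) ^+ 2 + f x - m).
  rewrite !big_split /= sumrN sumr_const -[m *+ _]mulr_natr /m divfK ?addrK //.
  by rewrite pnatr_eq0 -lt0n.
apply: ler_sum => x _; apply: kl_term_hellinger => //.
  by rewrite /m divr_ge0 ?sumr_ge0.
move=> /eqP; rewrite /m mulf_eq0 invr_eq0 pnatr_eq0 -[_ == 0%N]negbK -lt0n X0 orbF => /eqP.
by move=> s0; apply: (psumr_eq0P _ s0).
Qed.

(** Factor [f - u] as a difference [d] times a sum [s] of square roots: [d s <= 8 d^2 + s^2 / 32],
    and [s^2 <= 2 f + 2 u] sums to 4. A deficit [1/64] thus gives an l1 distance at most [1/4]. *)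
Lemma l1_le_deficit (X : finType) (f : X -> R) : (forall x, 0 <= f x) -> \sum_x f x = 1 ->
  \sum_x `|f x - #|X|%:R^-1| <= 8 * deficit f + 8^-1.
Proof.
move=> f0 f1; have := hellinger_le_deficit f0; rewrite f1 div1r; set u := _^-1.
have u0 : 0 <= u by rewrite invr_ge0.
have u1 : \sum_(x : X) u = 1.
  rewrite sumr_const -[_ *+ _]mulr_natr mulVf // pnatr_eq0 -lt0n lt0n; apply/eqP => X0.
  by move: f1; rewrite big1 => [/eqP|x _]; [rewrite eq_sym oner_eq0|have := fintype0 x X0].
move=> h; apply: (@le_trans _ _ (8 * (\sum_x (Num.sqrt (f x) - Num.sqrt u) ^+ 2) + 32^-1 * \sum_x (2 * f x + 2 * u))).
  rewrite !mulr_sumr -big_split; apply: ler_sum => x _ /=.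
  move: (sqr_sqrtr (f0 x)) (sqr_sqrtr u0) (sqrtr_ge0 (f x)) (sqrtr_ge0 u).
  move: (Num.sqrt (f x)) (Num.sqrt u) => a b <- <- a0 b0.
  rewrite subr_sqr normrM [`|a + b|]ger0_norm ?addr_ge0 //.
  rewrite -(real_normK (num_real (a - b))); move: `|a - b| => d.
  have := sqr_ge0 (16 * d - (a + b)); have := sqr_ge0 (a - b).
  rewrite !expr2; lra.
by rewrite big_split /= -!mulr_sumr f1 u1; lra.
Qed.

(* On a space of bounded size, the entropy deficit is comparable to the variance of the square root, hence satisfies a triangle inequality. *)
Lemma deficit_le_hellinger (X : finType) (f : X -> R) (c : R) : (forall x, 0 <= f x) ->
  deficit f <= 8 * #|X|%:R * \sum_x (Num.sqrt (f x) - c) ^+ 2.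
Proof.
move=> f0; rewrite deficitE; set S := \sum_y f y; set n : R := #|X|%:R; set m := S / n.
case: (posnP #|X|) => [X0|X0].
  by rewrite !big1 ?mulr0 // => x; have := fintype0 x X0.
have n1 : 1 <= n by rewrite /n ler1n.
have n0 : 0 < n by apply: lt_le_trans n1.
have fS x : f x <= S by rewrite /S (bigD1 x) //= lerDl sumr_ge0.
have S0 : 0 <= S by apply: sumr_ge0.
have Snm : S = n * m by rewrite /m mulrC divfK ?gt_eqF.
have sq x := sqr_sqrtr (f0 x).
have sq0 x := sqrtr_ge0 (f x).
have m0 : 0 <= m by rewrite divr_ge0 // ltW.
move: m0; rewrite le0r => /orP[/eqP m00|m0].
  have f00 x : f x = 0 by apply/eqP; rewrite eq_le f0 andbT (le_trans (fS x)) // Snm m00 mulr0.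
  rewrite big1 => [|x _]; last by rewrite f00 kl_term0.
  by rewrite !mulr_ge0 ?(ltW n0) // sumr_ge0 // => x _; rewrite sqr_ge0.
pose q := Num.sqrt m; have q0 : 0 < q by rewrite sqrtr_gt0.
have qm : q ^+ 2 = m by rewrite sqr_sqrtr // ltW.
pose s := \sum_x Num.sqrt (f x).
have s0 : 0 <= s by apply: sumr_ge0.
have sqE d : \sum_x (Num.sqrt (f x) - d) ^+ 2 = n * m - 2 * d * s + n * d ^+ 2.
  have -> : \sum_x (Num.sqrt (f x) - d) ^+ 2 = \sum_x (f x - 2 * d * Num.sqrt (f x) + d ^+ 2).
    by apply: eq_bigr => x _; rewrite sqrrB sq; ring.
  by rewrite big_split sumrB /= -mulr_sumr sumr_const -Snm -[d ^+ 2 *+ _]mulr_natl.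
(* Chi-square bound: [kl_term f m - f + m <= (f - m)^2 / m], which is [(sqrt f - q)^2] times
   [(sqrt f + q)^2 / m]; the last factor is at most [4 n] because [f <= n m]. *)
have h1 : \sum_x kl_term (f x) m <= 4 * n * \sum_x (Num.sqrt (f x) - q) ^+ 2.
  have -> : \sum_x kl_term (f x) m = \sum_x (kl_term (f x) m - f x + m).
    have sumc : \sum_(x : X) m = n * m by rewrite sumr_const -[m *+ _]mulr_natl.
    by rewrite big_split sumrB /= sumc -/S Snm subrK.
  rewrite mulr_sumr; apply: ler_sum => x _.
  have e1 : kl_term (f x) m <= f x * (f x / m - 1).
    have := f0 x; rewrite le0r => /orP[/eqP->|fx]; first by rewrite kl_term0 mul0r.
    rewrite /kl_term -ln_div ?posrE // ler_wpM2l ?f0 //; apply: ln_le_subr1; exact: divr_gt0.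
  have e2 : f x * (f x / m - 1) - f x + m = (Num.sqrt (f x) - q) ^+ 2 * ((Num.sqrt (f x) + q) ^+ 2 / m).
    by move: (sq x); move: (Num.sqrt (f x)) => a <-; rewrite -qm; field; rewrite gt_eqF.
  have e3 : (Num.sqrt (f x) + q) ^+ 2 / m <= 4 * n.
    rewrite ler_pdivrMr //; have := sq x; have := fS x; rewrite Snm.
    have := sqr_ge0 (Num.sqrt (f x) - q); have : m <= n * m by rewrite ler_peMl // ltW.
    by rewrite sqrrB sqrrD qm; lra.
  have := ler_wpM2l (sqr_ge0 (Num.sqrt (f x) - q)) e3; lra.
(* Replacing [q] by [c] costs a factor 2: the sum at [q] is [2 q (n q - s)], while the minimum over
   all centres is [(n q - s) (n q + s) / n], with [0 <= s <= n q]. *)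
apply: (le_trans h1); have -> : 8 * n * \sum_x (Num.sqrt (f x) - c) ^+ 2 = 4 * n * (2 * \sum_x (Num.sqrt (f x) - c) ^+ 2) by ring.
rewrite ler_wpM2l //; first by rewrite mulr_ge0 // ltW.
rewrite !sqE qm.
have snq : s <= n * q.
  have : 0 <= \sum_x (Num.sqrt (f x) - q) ^+ 2 by apply: sumr_ge0 => x _; apply: sqr_ge0.
  rewrite sqE qm -qm => h; rewrite -(ler_pM2l q0); lra.
rewrite -(ler_pM2l n0) -qm.
have := sqr_ge0 (n * c - s); have := mulr_ge0 s0 (_ : 0 <= n * q - s); rewrite subr_ge0 => /(_ snq).
lra.
Qed.

Lemma flat_avg (A X : finType) (alpha : A -> X -> X) f : resampling alpha -> flat (avg alpha f) = flat f.
Proof. by move=> ra; apply: funext => x; rewrite /flat sum_avg. Qed.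

(** No value exceeds the total mass, so each logarithmic ratio to the mean is at most [ln #|X|]. *)
Lemma deficit_le (X : finType) (f : X -> R) : (forall x, 0 <= f x) ->
  deficit f <= ln #|X|%:R * \sum_x f x.
Proof.
move=> f0; rewrite /deficit /entropy -sumrB mulr_sumr.
set S := \sum_x f x.
have -> : \sum_x (f x * ln (f x) - flat f x * ln (flat f x)) =
   \sum_x (f x * (ln (f x) - ln (S / #|X|%:R))).
  under [RHS]eq_bigr do rewrite mulrBr.
  rewrite !sumrB; congr (_ - _); rewrite -mulr_suml -/S.
  rewrite (eq_bigr (fun=> S / #|X|%:R * ln (S / #|X|%:R))) // sumr_const -[_ *+ _]mulr_natr.
  case: (posnP #|X|) => [c0|cX]; last by field; rewrite pnatr_eq0 -lt0n.
  by rewrite c0 mulr0 /S big1 ?mul0r // => x; have := fintype0 x c0.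
apply: ler_sum => x _; have := f0 x; rewrite le0r => /orP[/eqP->|fx0]; first by rewrite mul0r mulr0.
have cX : 0 < #|X|%:R :> R by rewrite ltr0n; apply/card_gt0P; exists x.
have fS : f x <= S by rewrite /S (bigD1 x) //= lerDl sumr_ge0.
have S0 : 0 < S by apply: lt_le_trans fS.
rewrite mulrC; apply: ler_wpM2r; first exact: f0.
rewrite ln_div ?posrE //; have : ln (f x) <= ln S by rewrite ler_ln ?posrE.
lra.
Qed.

Lemma entropy_jensen (K X : finType) (P : pred K) (w : K -> R) (f : K -> X -> R) :
  (forall k, 0 <= w k) -> \sum_(k | P k) w k = 1 -> (forall k x, 0 <= f k x) ->
  entropy (fun x => \sum_(k | P k) w k * f k x) <= \sum_(k | P k) w k * entropy (f k).
Proof.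
move=> w0 w1 f0; under [leRHS]eq_bigr do rewrite mulr_sumr.
rewrite exchange_big /=; apply: ler_sum => x _.
have := @log_sum K P (fun k => w k * f k x) w; rewrite w1 /kl_term ln1 subr0 => h; apply: le_trans (h _ _ _) _ => {h} //.
- by move=> k; rewrite mulr_ge0.
- by move=> k ->; rewrite mul0r.
apply: ler_sum => k _; have := w0 k; rewrite le0r => /orP[/eqP->|wk]; first by rewrite !mul0r.
have := f0 k x; rewrite le0r => /orP[/eqP->|fk]; first by rewrite !(mul0r, mulr0).
by rewrite lnM ?posrE // [ln _ + _]addrC addrK mulrA.
Qed.

(** * Subadditivity for commuting averages *)

Section CommutingFamily.
Variables (I : eqType) (A X : finType) (alpha : I -> A -> X -> X).
Hypothesis al : forall i, resampling (alpha i).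
Hypothesis alC : forall i j a b x, i != j -> alpha i a (alpha j b x) = alpha j b (alpha i a x).

Definition avgs (s : seq I) (f : X -> R) := foldr (fun i => avg (alpha i)) f s.

Lemma avgC i j f x : avg (alpha i) (avg (alpha j) f) x = avg (alpha j) (avg (alpha i) f) x.
Proof.
have [->//|ij] := eqVneq i j; apply: avg_comm => a b y.
by rewrite (alC _ _ _ ij).
Qed.

Lemma avgs_ge0 s f : (forall x, 0 <= f x) -> forall x, 0 <= avgs s f x.
Proof. by move=> f0; elim: s => //= i s IH x; apply: avg_ge0. Qed.

Lemma sum_avgs s f : \sum_x avgs s f x = \sum_x f x.
Proof. by elim: s => //= i s IH; rewrite sum_avg. Qed.

Lemma avgs_invariant s f i a x : i \in s -> avgs s f (alpha i a x) = avgs s f x.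
Proof.
elim: s x => //= j s IH x; rewrite inE; have [->|ij /= /IH is_] := eqVneq i j.
  by rewrite avg_invariant.
rewrite /avg; congr (_ * _); apply: eq_bigr => b _.
by rewrite -alC // is_.
Qed.

Lemma gain_avgs i s f : (forall x, 0 <= f x) -> gain (alpha i) (avgs s f) <= gain (alpha i) f.
Proof.
move=> f0; elim: s => //= j s IH; apply: le_trans IH.
by apply: gain_avg => //; [exact: avgs_ge0|move=> x; rewrite avgC].
Qed.

(** Telescoping: each gain is taken after other averages, which by [gain_avgs] can only lower it. *)
Lemma entropy_avgs s f : (forall x, 0 <= f x) ->
  entropy f - entropy (avgs s f) <= \sum_(i <- s) gain (alpha i) f.
Proof.
move=> f0; elim: s => [|i s IH]; first by rewrite /= subrr big_nil.
rewrite big_cons /=; have := gain_avgs i s f0; rewrite [X in X <= _]/gain; lra.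
Qed.

Lemma deficit_avgs s f : (forall x, 0 <= f x) ->
  (forall x y, avgs s f x = avgs s f y) ->
  deficit f <= \sum_(i <- s) gain (alpha i) f.
Proof.
move=> f0 cst; rewrite /deficit; suff -> : flat f = avgs s f by apply: entropy_avgs.
apply: funext => x; rewrite /flat -(sum_avgs s).
rewrite (eq_bigr (fun=> avgs s f x)) // sumr_const -[_ *+ _]mulr_natr mulfK //.
by rewrite pnatr_eq0 -lt0n; apply/card_gt0P; exists x.
Qed.

End CommutingFamily.

End Entropy.

(** * Product replacement with an abstract action *)

Section Replacement.
(** The action is abstract because the walk is used twice: for [T] the Heisenberg group, and for
    [T = 'F_p] when a functional is applied to the rows. *)
Variables (R : realType) (r : nat) (A T : finType) (act : bool -> T -> A -> T -> T).
Hypothesis act_resampling : forall s t, resampling R (act s t).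
Hypothesis T_gt0 : (0 < #|T|)%N.

Notation config := {ffun 'I_r -> T}.
Implicit Types (g : config) (f h : config -> R).

Definition upd (i : 'I_r) (x : T) (g : config) : config := [ffun k => if k == i then x else g k].

Lemma upd_id i g : upd i (g i) g = g.
Proof. by apply/ffunP => k; rewrite ffunE; case: eqP => // ->. Qed.

Lemma upd_upd i x y g : upd i x (upd i y g) = upd i x g.
Proof. by apply/ffunP => k; rewrite !ffunE; case: eqP. Qed.

Lemma upd_at i x g : upd i x g i = x.
Proof. by rewrite ffunE eqxx. Qed.

Lemma upd_other i j x g : j != i -> upd i x g j = g j.
Proof. by rewrite ffunE => /negbTE->. Qed.

Lemma sum_upd i (F : config -> R) : \sum_g \sum_x F (upd i x g) = #|T|%:R * \sum_g F g.
Proof.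
(* Exchanging the new value with the old coordinate is an involution on pairs. *)
pose h (q : config * T) := (upd i q.2 q.1, q.1 i).
have hK : involutive h.
  by move=> [g x]; rewrite /h /= upd_at upd_upd upd_id.
rewrite pair_big /= (reindex_inj (inv_inj hK)) /=.
under eq_bigr do rewrite upd_upd upd_id.
rewrite -(pair_big xpredT xpredT (fun g (x : T) => F g)) /= mulr_sumr.
by apply: eq_bigr => g _; rewrite sumr_const -[F g *+ _]mulr_natl.
Qed.

Lemma site_resampling i : resampling R (upd i).
Proof.
split => // [F|f a x|x]; first exact: sum_upd.
- by apply: eq_bigr => b _; rewrite upd_upd.
- by exists (x i); rewrite upd_id.
Qed.

Let T0 : #|T|%:R != 0 :> R.
Proof. by rewrite pnatr_eq0 -lt0n. Qed.

Lemma sum_fiber i (F : config -> R) : \sum_g F g = #|T|%:R^-1 * \sum_g \sum_x F (upd i x g).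
Proof. by rewrite sum_upd mulKf. Qed.

Definition fiber i g (f : config -> R) : T -> R := fun x => f (upd i x g).

Lemma gain_site i f : gain (upd i) f = #|T|%:R^-1 * \sum_g deficit (fiber i g f).
Proof.
rewrite /gain /entropy (sum_fiber i) [X in _ - X](sum_fiber i) -mulrBr -sumrB.
congr (_ * _); apply: eq_bigr => g _; congr (_ - _).
apply: eq_bigr => x _; suff -> : avg (upd i) f (upd i x g) = flat (fiber i g f) x by [].
by rewrite /avg /flat mulrC; congr (_ * _); apply: eq_bigr => y _; rewrite upd_upd.
Qed.

Definition repl (i j : 'I_r) (s : bool) (a : A) (g : config) : config :=
  upd i (act s (g j) a (g i)) g.

Lemma repl_upd i j s a x g : j != i ->
  repl i j s a (upd i x g) = upd i (act s (g j) a x) g.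
Proof. by move=> ji; rewrite /repl upd_upd upd_at upd_other. Qed.

Lemma avg_repl_upd i j s f x g : j != i ->
  avg (repl i j s) f (upd i x g) = avg (act s (g j)) (fiber i g f) x.
Proof.
by move=> ji; rewrite /avg; congr (_ * _); apply: eq_bigr => a _; rewrite repl_upd.
Qed.

Lemma repl_resampling i j s : j != i -> resampling R (repl i j s).
Proof.
move=> ji; split.
- by case: (card_gt0P T_gt0) => t _; case: (act_resampling s t).
- move=> F; rewrite [LHS](sum_fiber i) [in RHS](sum_fiber i F) mulrCA; congr (_ * _).
  rewrite mulr_sumr; apply: eq_bigr => g _.
  case: (act_resampling s (g j)) => _ h _ _; rewrite -(h (fiber i g F)).
  by apply: eq_bigr => x _; apply: eq_bigr => a _; rewrite repl_upd.
- move=> f a g; rewrite -{1 2}(upd_id i g) repl_upd // upd_id.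
  case: (act_resampling s (g j)) => _ _ h _; move: (h (fiber i g f) a (g i)).
  rewrite /fiber => {}h; rewrite -[X in _ = X]h; apply: eq_bigr => b _.
  by rewrite repl_upd.
- move=> g; case: (act_resampling s (g j)) => _ _ _ /(_ (g i))[a ha].
  by exists a; rewrite /repl ha upd_id.
Qed.

Lemma gain_repl i j s f : j != i ->
  gain (repl i j s) f = #|T|%:R^-1 * \sum_(g : config) gain (act s (g j)) (fiber i g f).
Proof.
move=> ji; rewrite /gain /entropy (sum_fiber i) [X in _ - X](sum_fiber i) -mulrBr -sumrB.
congr (_ * _); apply: eq_bigr => g _; congr (_ - _).
by apply: eq_bigr => x _; rewrite avg_repl_upd.
Qed.

Lemma site_invariant_const (F : config -> R) :
  (forall i x g, F (upd i x g) = F g) -> forall g g', F g = F g'.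
Proof.
move=> inv g g'.
pose m (l : seq 'I_r) : config := [ffun k => if k \in l then g' k else g k].
have h l : F (m l) = F g.
  elim: l => [|i l IH]; first by congr F; apply/ffunP => k; rewrite ffunE.
  rewrite -IH -[RHS](inv i (g' i)); congr F; apply/ffunP => k; rewrite !ffunE inE.
  by case: eqP => [->|].
by rewrite -(h (enum 'I_r)); congr F; apply/ffunP => k; rewrite ffunE mem_enum.
Qed.

(** Site averages commute and together flatten everything: subadditivity of entropy on a product
    space. *)
Lemma deficit_tensor f : (forall g, 0 <= f g) -> deficit f <= \sum_i gain (upd i) f.
Proof.
move=> f0; rewrite -big_enum /=; apply: deficit_avgs => //.
- exact: site_resampling.
- move=> i j a b g ij; apply/ffunP => k; rewrite !ffunE.
  by case: eqP => [->|//]; rewrite (negbTE ij).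
- by apply: site_invariant_const => i x g; apply: avgs_invariant; rewrite ?mem_enum //;
    [exact: site_resampling|move=> i1 j1 a b g1 ij; apply/ffunP => k; rewrite !ffunE;
    case: eqP => [->|//]; rewrite (negbTE ij)].
Qed.

(** * The half-lazy walk as an operator *)

Notation move := ('I_r * 'I_r * bool)%type.

Definition dist_move : pred move := fun k => k.1.2 != k.1.1.

Definition avg_move (k : move) f := avg (repl k.1.1 k.1.2 k.2) f.

Definition nmoves : R := (2 * r * (r - 1))%N%:R.

Definition Qop (f : config -> R) : config -> R :=
  fun g => 2^-1 * (f g + nmoves^-1 * \sum_(k | dist_move k) avg_move k f g).

Lemma sum_moves (F : 'I_r -> 'I_r -> bool -> R) :
  \sum_(k | dist_move k) F k.1.1 k.1.2 k.2 =
  \sum_i \sum_(j | j != i) \sum_s F i j s.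
Proof.
rewrite [RHS]pair_big_dep /= [RHS]pair_big_dep /=.
by apply: eq_bigl => -[[i j] s]; rewrite /dist_move /= andbT.
Qed.

Lemma sum_moves1 : \sum_(k | dist_move k) 1 = nmoves :> R.
Proof.
rewrite (sum_moves (fun _ _ _ => 1)) (eq_bigr (fun=> (2 * (r - 1))%N%:R)) => [|i _].
  by rewrite sumr_const card_ord -[_ *+ r]mulr_natr -natrM /nmoves; congr (_%:R); ring.
under eq_bigr do rewrite sumr_const card_bool.
rewrite sumr_const -mulrnA; congr (_ *+ _); congr (_ * _)%N.
by have := cardC1 i; rewrite card_ord -subn1 => <-.
Qed.

Hypothesis r_gt1 : (1 < r)%N.

Let nm0 : 0 < nmoves.
Proof. by rewrite /nmoves ltr0n; move: r_gt1; nia. Qed.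

Lemma avg_move_ge0 k f : (forall g, 0 <= f g) -> forall g, 0 <= avg_move k f g.
Proof. by move=> f0 g; rewrite mulr_ge0 ?invr_ge0 ?ler0n // sumr_ge0. Qed.

Lemma Qop_ge0 f : (forall g, 0 <= f g) -> forall g, 0 <= Qop f g.
Proof.
move=> f0 g; rewrite mulr_ge0 ?invr_ge0 // addr_ge0 // mulr_ge0 ?invr_ge0 ?(ltW nm0) //.
by apply: sumr_ge0 => k _; apply: avg_move_ge0.
Qed.

(** Each [avg_move k] is a conditional expectation, hence self-adjoint for the counting measure. So
    [Qit t] evolves densities as well as observables: on a Dirac mass it gives the law at time
    [t]. *)
Lemma sum_Qop_mul f h : \sum_g Qop f g * h g = \sum_g f g * Qop h g.
Proof.
have key k : dist_move k -> \sum_g avg_move k f g * h g = \sum_g f g * avg_move k h g.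
  move=> dk; have ra := repl_resampling k.2 dk.
  have inv F a g : avg_move k F (repl k.1.1 k.1.2 k.2 a g) = avg_move k F g by apply: avg_invariant.
  rewrite -(sum_mul_avg ra _ (inv h)) [RHS](eq_bigr (fun g => avg_move k h g * avg_move k f g)) => [|g _]; last by rewrite mulrC.
  rewrite (sum_mul_avg ra _ (inv f)).
  by apply: eq_bigr => g _; rewrite mulrC.
have e1 : \sum_g Qop f g * h g = 2^-1 * (\sum_g f g * h g + nmoves^-1 * \sum_(k | dist_move k) \sum_g avg_move k f g * h g).
  rewrite exchange_big /= mulr_sumr -big_split mulr_sumr; apply: eq_bigr => g _ /=.
  by rewrite /Qop -mulr_suml; ring.
have e2 : \sum_g f g * Qop h g = 2^-1 * (\sum_g f g * h g + nmoves^-1 * \sum_(k | dist_move k) \sum_g f g * avg_move k h g).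
  rewrite exchange_big /= mulr_sumr -big_split mulr_sumr; apply: eq_bigr => g _ /=.
  rewrite /Qop -(mulr_sumr _ _ (fun k => avg_move k h g) (f g)); ring.
by rewrite e1 e2 (eq_bigr _ key).
Qed.

Lemma Qop_const c g : Qop (fun=> c) g = c.
Proof.
rewrite /Qop (eq_bigr (fun=> c * 1)) => [|k dk].
  by rewrite -mulr_sumr sum_moves1; move: nm0; generalize nmoves => n n0; field; rewrite gt_eqF.
by rewrite mulr1; apply: (@avg_id _ _ _ _ (repl_resampling k.2 dk) (fun=> c)).
Qed.

Lemma sum_Qop f : \sum_g Qop f g = \sum_g f g.
Proof.
have := sum_Qop_mul f (fun=> 1).
under eq_bigr do rewrite mulr1; under [in RHS]eq_bigr do rewrite Qop_const mulr1.
by [].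
Qed.

Definition Qit (t : nat) f := iter t Qop f.

Lemma Qit_ge0 t f : (forall g, 0 <= f g) -> forall g, 0 <= Qit t f g.
Proof. by move=> f0; elim: t => //= t IH; apply: Qop_ge0. Qed.

Lemma sum_Qit t f : \sum_g Qit t f g = \sum_g f g.
Proof. by elim: t => //= t IH; rewrite sum_Qop. Qed.

Lemma sum_Qit_mul t f h : \sum_g Qit t f g * h g = \sum_g f g * Qit t h g.
Proof.
elim: t f h => //= t IH f h; rewrite sum_Qop_mul IH.
by apply: eq_bigr => g _; rewrite /Qit -iterS iterSr.
Qed.

Definition dirac_at (x : config) : config -> R := fun g => (x == g)%:R.

Lemma dirac_ge0 x g : 0 <= dirac_at x g.
Proof. by rewrite ler0n. Qed.

Lemma sum_dirac_mul x h : \sum_g dirac_at x g * h g = h x.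
Proof.
rewrite (bigD1 x) //= big1 ?addr0 /dirac_at ?eqxx ?mul1r // => g gx.
by rewrite eq_sym (negbTE gx) mul0r.
Qed.

Lemma sum_dirac x : \sum_g dirac_at x g = 1.
Proof. by have := sum_dirac_mul x (fun=> 1); under eq_bigr do rewrite mulr1. Qed.

Lemma QitE t f x : Qit t f x = \sum_g Qit t (dirac_at x) g * f g.
Proof. by rewrite sum_Qit_mul sum_dirac_mul. Qed.

Lemma Qit_mono t f h : (forall g, f g <= h g) -> forall g, Qit t f g <= Qit t h g.
Proof.
move=> fh g; rewrite !QitE; apply: ler_sum => y _; rewrite ler_wpM2l //.
by apply: Qit_ge0 => z; apply: dirac_ge0.
Qed.

Lemma Qit_addc t f c x : Qit t (fun g => f g + c) x = Qit t f x + c.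
Proof.
rewrite QitE (QitE t f) -{2}[c]mul1r -(sum_dirac x) -(sum_Qit t) mulr_suml -big_split.
by apply: eq_bigr => g _; rewrite mulrDr.
Qed.

Lemma Qit_scale t f c x : Qit t (fun g => c * f g) x = c * Qit t f x.
Proof. by rewrite QitE (QitE t f) mulr_sumr; apply: eq_bigr => g _; rewrite mulrCA. Qed.

Lemma Qit_le c t f : (forall g, f g <= c) -> forall g, Qit t f g <= c.
Proof.
move=> fc g; have := @Qit_mono t f (fun=> 0 + c) _ g; rewrite (Qit_addc t (fun=> 0)).
rewrite (QitE t (fun=> 0)) big1 => [|y _]; last by rewrite mulr0.
by rewrite add0r; apply.
Qed.

Lemma Qit_add s t f : Qit (s + t) f = Qit s (Qit t f).
Proof. by rewrite /Qit iterD. Qed.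

(** * Contraction of oscillation away from a fixed configuration *)

Section Absorbing.
Variable z : config.
Hypothesis z_fix : forall k a, repl k.1.1 k.1.2 k.2 a z = z.

Lemma Qop_fixed f : Qop f z = f z.
Proof.
rewrite -[RHS](Qop_const (f z) z) /Qop; congr (_ * (_ + _ * _)).
apply: eq_bigr => k dk; rewrite /avg_move /avg; congr (_ * _); apply: eq_bigr => a _.
by rewrite z_fix.
Qed.

Lemma Qit_fixed t f : Qit t f z = f z.
Proof. by elim: t => //= t <-; rewrite Qop_fixed. Qed.

(** By reversibility a fixed configuration cannot be entered from elsewhere, so a law started off
    [z] gives it no mass. *)
Lemma Qit_mono_off t f h : (forall g, g != z -> f g <= h g) ->
  forall g, g != z -> Qit t f g <= Qit t h g.
Proof.
move=> fh g gz; rewrite !QitE; apply: ler_sum => y _.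
have [->|yz] := eqVneq y z; first by rewrite Qit_fixed /dirac_at (negbTE gz) !mul0r.
by rewrite ler_wpM2l ?fh //; apply: Qit_ge0 => w; apply: dirac_ge0.
Qed.

(** Dobrushin contraction: the two laws have equal mass, so [f x] may be subtracted from [f], and an
    l1 distance [1/2] then multiplies values at most [d]. *)
Lemma Qit_osc t f d : 
  (forall x y, x != z -> y != z -> \sum_g `|Qit t (dirac_at x) g - Qit t (dirac_at y) g| <= 2^-1) ->
  (forall x y, x != z -> y != z -> `|f x - f y| <= d) ->
  forall x y, x != z -> y != z -> `|Qit t f x - Qit t f y| <= d / 2.
Proof.
move=> l1 osc x y xz yz.
have e : Qit t f x - Qit t f y =
    \sum_g (Qit t (dirac_at x) g - Qit t (dirac_at y) g) * (f g - f x).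
  rewrite (eq_bigr (fun g => Qit t (dirac_at x) g * f g - Qit t (dirac_at y) g * f g -
     (Qit t (dirac_at x) g - Qit t (dirac_at y) g) * f x)) => [|g _]; last by ring.
  by rewrite !sumrB -mulr_suml sumrB !sum_Qit !sum_dirac subrr mul0r subr0 -!QitE.
have d0 : 0 <= d by apply: le_trans (osc x x xz xz).
rewrite e; apply: le_trans (ler_norm_sum _ _ _) _.
apply: (@le_trans _ _ (\sum_g `|Qit t (dirac_at x) g - Qit t (dirac_at y) g| * d)).
  apply: ler_sum => g _; rewrite normrM.
  have [->|gz] := eqVneq g z; last by rewrite ler_wpM2l // osc.
  by rewrite !Qit_fixed /dirac_at (negbTE xz) (negbTE yz) subrr normr0 !mul0r.
by rewrite -mulr_suml mulrC ler_wpM2l // l1.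
Qed.

End Absorbing.

(** Jensen twice: for the lazy half, then for the uniform mixture of moves, each of which lowers the
    entropy by its gain. *)
Lemma entropy_Qop f : (forall g, 0 <= f g) ->
  entropy (Qop f) <= entropy f -
    (2 * nmoves)^-1 * \sum_(k | dist_move k) gain (repl k.1.1 k.1.2 k.2) f.
Proof.
move=> f0.
pose P f g := \sum_(k | dist_move k) nmoves^-1 * avg_move k f g.
have P0 g : 0 <= P f g.
  by apply: sumr_ge0 => k _; rewrite mulr_ge0 ?invr_ge0 ?(ltW nm0) ?avg_move_ge0.
have e1 : entropy (Qop f) <= 2^-1 * entropy f + 2^-1 * entropy (P f).
  have := @entropy_jensen R bool _ xpredT (fun=> 2^-1) (fun b : bool => if b then f else P f).
  rewrite !big_bool /= => h; apply: le_trans (h _ _ _).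
  - rewrite le_eqVlt; apply/orP; left; apply/eqP; congr entropy; apply: funext => g.
    by rewrite big_bool /= /P -mulr_sumr /Qop; ring.
  - by move=> b; rewrite invr_ge0.
  - by field.
  - by case.
have e2 : entropy (P f) <= \sum_(k | dist_move k) nmoves^-1 * entropy (avg_move k f).
  apply: entropy_jensen => [k||k g]; first by rewrite invr_ge0 ltW.
    rewrite (eq_bigr (fun=> nmoves^-1 * 1)) => [|k _]; last by rewrite mulr1.
    by rewrite -mulr_sumr sum_moves1 mulVf ?gt_eqF.
  exact: avg_move_ge0.
have e3 : \sum_(k | dist_move k) nmoves^-1 * entropy (avg_move k f) =
   entropy f - nmoves^-1 * \sum_(k | dist_move k) gain (repl k.1.1 k.1.2 k.2) f.
  rewrite -mulr_sumr /gain sumrB [X in _ - _ * (X - _)](eq_bigr (fun=> entropy f * 1)) => [|k _]; last by rewrite mulr1.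
  by rewrite -mulr_sumr sum_moves1 mulrBr mulrCA mulVf ?gt_eqF // mulr1 subKr.
rewrite e3 in e2; rewrite invfM; lra.
Qed.

(** Tensorize the deficit over coordinates and compare fibre by fibre. Since [good i] ignores
    coordinate [i], a fibre is entirely good or bad: good ones satisfy the local inequality, and bad
    ones have deficit at most [ln #|T|] times their mass. *)
Lemma deficit_Qop (good : 'I_r -> pred config) (kappa : R) f :
  0 <= kappa -> (forall g, 0 <= f g) ->
  (forall i x g, good i (upd i x g) = good i g) ->
  (forall i g (F : T -> R), good i g -> (forall x, 0 <= F x) ->
     kappa * deficit F <= \sum_(j | j != i) \sum_s gain (act s (g j)) F) ->
  deficit (Qop f) <= deficit f - kappa / (2 * nmoves) *
     (deficit f - ln #|T|%:R * \sum_i \sum_(g | ~~ good i g) f g).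
Proof.
move=> k0 f0 goodP loc.
have -> : deficit (Qop f) = entropy (Qop f) - entropy (flat f).
  by rewrite /deficit; congr (_ - entropy _); apply: funext => g; rewrite /flat sum_Qop.
have main : kappa * (deficit f - ln #|T|%:R * \sum_i \sum_(g | ~~ good i g) f g) <=
    \sum_(k | dist_move k) gain (repl k.1.1 k.1.2 k.2) f.
  rewrite (sum_moves (fun i j s => gain (repl i j s) f)).
  apply: (@le_trans _ _ (\sum_i kappa * (gain (upd i) f - ln #|T|%:R * \sum_(g | ~~ good i g) f g))).
    rewrite -mulr_sumr ler_wpM2l // sumrB -mulr_sumr lerB //; exact: deficit_tensor.
  apply: ler_sum => i _.
  have -> : \sum_(j | j != i) \sum_s gain (repl i j s) f =
     #|T|%:R^-1 * \sum_(g : config) \sum_(j | j != i) \sum_s gain (act s (g j)) (fiber i g f).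
    rewrite [in RHS]exchange_big mulr_sumr; apply: eq_bigr => j ji; rewrite [in RHS]exchange_big mulr_sumr.
    by apply: eq_bigr => s _; rewrite gain_repl.
  have -> : \sum_(g | ~~ good i g) f g = #|T|%:R^-1 * \sum_(g | ~~ good i g) \sum_x fiber i g f x.
    rewrite big_mkcond (sum_fiber i) [in RHS]big_mkcond; congr (_ * _); apply: eq_bigr => g _.
    case gg: (good i g) => /=.
      by apply: big1 => x _; rewrite goodP gg.
    by apply: eq_bigr => x _; rewrite goodP gg.
  rewrite gain_site mulrCA -mulrBr mulrCA ler_wpM2l ?invr_ge0 ?ler0n //.
  rewrite mulr_sumr [X in _ - X]big_mkcond -sumrB mulr_sumr; apply: ler_sum => g _.
  have F0 x : 0 <= fiber i g f x by apply: f0.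
  case: ifPn => [_|]; last by rewrite subr0 negbK => /loc; apply.
  apply: (@le_trans _ _ 0).
    by rewrite mulr_ge0_le0 // subr_le0 deficit_le.
  by apply: sumr_ge0 => j _; apply: sumr_ge0 => s _; apply: gain_ge0.
have i0 : 0 <= (2 * nmoves)^-1 by rewrite invr_ge0 mulr_ge0 // ltW.
have := ler_wpM2l i0 main; have := entropy_Qop f0.
rewrite /deficit; set e := entropy f - entropy (flat f).
set G := \sum_(k | _) _; set B := ln _ * _; move=> h1 h2.
have -> : kappa / (2 * nmoves) * (e - B) = (2 * nmoves)^-1 * (kappa * (e - B)) by ring.
rewrite /e in h2 *; lra.
Qed.

End Replacement.

(** * Actions on the Heisenberg group *)

(** The classes are the orbits, over which a uniform group element spreads a point uniformly. *)
Lemma action_resampling (R : realType) (A : finZmodType) (X : finType) (alpha : A -> X -> X) :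
  (forall x, alpha 0 x = x) -> (forall a b x, alpha a (alpha b x) = alpha (a + b) x) ->
  resampling R alpha.
Proof.
move=> a0 aD; split.
- by apply/card_gt0P; exists 0.
- move=> F; rewrite exchange_big /= (eq_bigr (fun=> \sum_x F x)) => [|a _].
    by rewrite sumr_const -[_ *+ _]mulr_natl.
  rewrite [RHS](reindex_inj (h := alpha a)) //.
  by apply: (can_inj (g := alpha (- a))) => x; rewrite aD addNr a0.
- move=> f a x; rewrite [RHS](reindex_inj (addIr a)) /=.
  by apply: eq_bigr => b _; rewrite aD.
- by move=> x; exists 0.
Qed.

Section Form.
Variables (p h : nat) (om : 'M['F_p]_h).
Local Notation W := 'rV['F_p]_h.
Local Notation "<| v , w |>" := (Defs.form om v w).

Lemma formDl u v w : <|u + v, w|> = <|u, w|> + <|v, w|>.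
Proof. by rewrite /Defs.form !mulmxDl mxE. Qed.
Lemma formZl a u w : <|a *: u, w|> = a * <|u, w|>.
Proof. by rewrite /Defs.form -!scalemxAl mxE. Qed.
Lemma formDr u v w : <|w, u + v|> = <|w, u|> + <|w, v|>.
Proof. by rewrite /Defs.form linearD mulmxDr mxE. Qed.
Lemma formZr a u w : <|w, a *: u|> = a * <|w, u|>.
Proof. by rewrite /Defs.form linearZ -scalemxAr mxE. Qed.

Hypothesis alt : alternating_form om.

Lemma form_alt v : <|v, v|> = 0. Proof. by case: alt => _ []. Qed.

Lemma form_skew v w : <|v, w|> = - <|w, v|>.
Proof.
apply/eqP; rewrite -addr_eq0; apply/eqP.
by have := form_alt (v + w); rewrite formDl !formDr !form_alt add0r addr0.
Qed.

(* [heis_act true] and [heis_act false] are right and left multiplication by the powers of [t], in coordinates. *)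
Definition heis_act (s : bool) (t : heis p h) (a : 'F_p) (x : heis p h) : heis p h :=
  (x.1 + a *: t.1, x.2 + a * t.2 + (if s then 1 else -1) * (2%:R^-1 * a) * <|x.1, t.1|>).

Definition zshift (a : 'F_p) (x : heis p h) : heis p h := (x.1, x.2 + a).
(** Not a multiplication in the group: the cocycle is dropped so that these maps commute. It agrees
    with [heis_act true] up to a central shift. *)
Definition wshift (v : W) (a : 'F_p) (x : heis p h) : heis p h := (x.1 + a *: v, x.2).
(** Conjugation by the powers of [t], which moves only the central coordinate. *)
Definition zconj (t : heis p h) (a : 'F_p) (x : heis p h) : heis p h :=
  (x.1, x.2 + a * <|x.1, t.1|>).

Variable R : realType.

Lemma zshift_resampling : resampling R zshift.
Proof.
by apply: action_resampling => [[v z]|a b [v z]]; rewrite /zshift /= ?addr0 // -addrA [b + a]addrC.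
Qed.

Lemma wshift_resampling v : resampling R (wshift v).
Proof.
apply: action_resampling => [[w z]|a b [w z]]; rewrite /wshift /= ?scale0r ?addr0 //.
by rewrite -addrA -scalerDl [b + a]addrC.
Qed.

Lemma zconj_resampling t : resampling R (zconj t).
Proof.
apply: action_resampling => [[w z]|a b [w z]]; rewrite /zconj /= ?mul0r ?addr0 //.
by rewrite -addrA -mulrDl [b + a]addrC.
Qed.

Lemma heis_act_resampling s t : resampling R (heis_act s t).
Proof.
apply: action_resampling => [[w z]|a b [w z]]; rewrite /heis_act /=.
  by rewrite !(scale0r, mul0r, mulr0, addr0).
rewrite -addrA -scalerDl formDl formZl form_alt; congr (_, _); first by rewrite [b + a]addrC.
by ring.
Qed.

Lemma zshift_heis_act s t a b x : zshift a (heis_act s t b x) = heis_act s t b (zshift a x).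
Proof. by rewrite /zshift /heis_act /=; congr (_, _); ring. Qed.

Lemma zshift_wshift v a b x : zshift a (wshift v b x) = wshift v b (zshift a x).
Proof. by []. Qed.

Lemma wshiftC u v a b x : wshift u a (wshift v b x) = wshift v b (wshift u a x).
Proof. by rewrite /wshift /= addrAC. Qed.

Lemma heis_actC t a b x : heis_act true t a (heis_act false t b x) = heis_act false t b (heis_act true t a x).
Proof.
rewrite /heis_act /= !formDl !formZl form_alt addrAC; congr (_, _); ring.
Qed.

Lemma zconj_heis_act s t a b x : zconj t a (heis_act s t b x) = heis_act s t b (zconj t a x).
Proof.
rewrite /zconj /heis_act /= !formDl !formZl form_alt; congr (_, _); ring.
Qed.

Hypothesis two_neq0 : 2%:R != 0 :> 'F_p.

Lemma zconjE t a x : zconj t a x = heis_act true t a (heis_act false t (- a) x).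
Proof.
rewrite /zconj /heis_act /= !formDl !formZl form_alt -addrA -scalerDl addNr scale0r addr0.
by congr (_, _); field.
Qed.

Lemma heis_act_wshift t a x : heis_act true t a x = zshift (a * t.2 + 2%:R^-1 * a * <|x.1, t.1|>) (wshift t.1 a x).
Proof. by rewrite /heis_act /zshift /wshift /=; congr (_, _); ring. Qed.

Section Local.
Variable f : heis p h -> R.
Hypothesis f0 : forall x, 0 <= f x.

Definition zdeficit (w : W) := deficit (fun z : 'F_p => f (w, z)).

Lemma zdeficit_ge0 w : 0 <= zdeficit w.
Proof. by apply: deficit_ge0. Qed.

Lemma sum_heis (F : heis p h -> R) : \sum_x F x = \sum_(w : W) \sum_(z : 'F_p) F (w, z).
Proof. by rewrite pair_big /=; apply: eq_bigr => -[]. Qed.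

Lemma avg_zshiftE w z : avg zshift f (w, z) = flat (fun z => f (w, z)) z.
Proof.
rewrite /avg /flat mulrC; congr (_ / _); rewrite /zshift /=.
by rewrite [RHS](reindex_inj (addrI z)).
Qed.

Lemma gain_zshift : gain zshift f = \sum_w zdeficit w.
Proof.
rewrite /gain /entropy !sum_heis -sumrB; apply: eq_bigr => w _; congr (_ - _).
by apply: eq_bigr => z _; rewrite avg_zshiftE.
Qed.

(** Over [w] with nonzero pairing, the central shift runs through all of ['F_p] and flattens the
    fibre; over the other [w] it is the identity. *)
Lemma gain_zconj t : gain (zconj t) f = \sum_(w | <|w, t.1|> != 0) zdeficit w.
Proof.
rewrite /gain /entropy !sum_heis -sumrB [RHS]big_mkcond; apply: eq_bigr => w _.
case: ifPn => [wt|]; last first.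
  rewrite negbK => /eqP wt; apply/eqP; rewrite subr_eq0; apply/eqP; apply: eq_bigr => z _.
  by rewrite (avg_id (zconj_resampling t)) // => a; rewrite /zconj /= wt mulr0 addr0.
congr (_ - _); apply: eq_bigr => z _; suff -> : avg (zconj t) f (w, z) = flat (fun z => f (w, z)) z by [].
rewrite -avg_zshiftE /avg; congr (_ * _).
by rewrite [RHS](reindex_inj (mulIf wt)).
Qed.

(* [avg (zconj t)] is absorbed by left averaging composed with right averaging, two commuting projections. *)
Lemma gain_zconj_le t : gain (zconj t) f <= \sum_s gain (heis_act s t) f.
Proof.
set L := heis_act false t; set T := heis_act true t.
have rL : resampling R L := heis_act_resampling false t.
have rT : resampling R T := heis_act_resampling true t.
have rC : resampling R (zconj t) := zconj_resampling t.
have CT F x : avg T (avg (zconj t) F) x = avg (zconj t) (avg T F) x.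
  by apply: avg_comm => a b y; apply: zconj_heis_act.
have CL F x : avg L (avg (zconj t) F) x = avg (zconj t) (avg L F) x.
  by apply: avg_comm => a b y; apply: zconj_heis_act.
have TL F x : avg L (avg T F) x = avg T (avg L F) x.
  by apply: avg_comm => a b y; apply: heis_actC.
have e x : avg L (avg T (avg (zconj t) f)) x = avg L (avg T f) x.
  have -> : avg T (avg (zconj t) f) = avg (zconj t) (avg T f) by apply: funext => y; rewrite CT.
  rewrite CL; apply: avg_id => // a.
  by rewrite zconjE TL -/T -/L avg_invariant // -TL avg_invariant.
(* Averaging the conjugated function by [T] and then [L] only loses entropy and ends at
   [avg L (avg T f)], whose total gain from [f] splits into the two one-sided gains. *)
have h1 : 0 <= gain T (avg (zconj t) f) by apply: gain_ge0 => //; apply: avg_ge0.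
have h2 : 0 <= gain L (avg T (avg (zconj t) f)).
  by apply: gain_ge0 => // x; apply: avg_ge0 => y; apply: avg_ge0.
have h3 : gain L (avg T f) <= gain L f by apply: gain_avg => // x; rewrite TL.
have e' : avg L (avg T (avg (zconj t) f)) = avg L (avg T f) by apply: funext.
rewrite big_bool /=; move: h1 h2 h3; rewrite /gain e'; lra.
Qed.

End Local.
End Form.

(** * Entropy inequality on the Heisenberg group *)

Section Spanning.
Variables (p h r : nat) (om : 'M['F_p]_h).
Local Notation W := 'rV['F_p]_h.

(** Dual form of spanning, by functionals, as required by the union bound over [u]. *)
Definition spans (B : pred 'I_r) (t : tuples p h r) : bool :=
  [forall u : 'cV['F_p]_h, [forall j, B j ==> ((t j).1 *m u == 0)] ==> (u == 0)].

Lemma spansP (B : pred 'I_r) (t : tuples p h r) :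
  reflect (forall u : 'cV['F_p]_h, (forall j, B j -> (t j).1 *m u = 0) -> u = 0) (spans B t).
Proof.
apply: (iffP forallP) => [H u hu|H u].
  have /implyP := H u => /(_ _)/eqP; apply; apply/forallP => j; apply/implyP => Bj.
  by rewrite hu.
apply/implyP => /forallP hu; apply/eqP/H => j Bj; apply/eqP.
by have /implyP := hu j; apply.
Qed.

Lemma spans_combination (B : pred 'I_r) (t : tuples p h r) : spans B t -> forall w : W,
  exists c : 'I_r -> 'F_p, w = \sum_(j | B j) c j *: (t j).1.
Proof.
move=> /spansP sp w.
pose M : 'M['F_p]_(r, h) := \matrix_(j < r) (if B j then (t j).1 else 0).
(* Only [u = 0] is annihilated by every row, so [M] has full column rank; a one-sided inverse
   supplies the coefficients. *)
have : row_free M^T.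
  apply: inj_row_free => v vM; apply: trmx_inj; rewrite trmx0; apply: sp => j Bj.
  have /(congr1 trmx)/(congr1 (row j)) := vM.
  by rewrite trmx_mul trmxK trmx0 row0 row_mul rowK Bj.
case/row_freeP => N /(congr1 trmx); rewrite trmx_mul trmxK trmx1 => NM.
exists (fun j => (w *m N^T) 0 j).
rewrite -[LHS]mulmx1 -NM mulmxA mulmx_sum_row [RHS]big_mkcond; apply: eq_bigr => j _.
by rewrite rowK; case: ifP => //; rewrite scaler0.
Qed.

Hypothesis p_prime : prime p.
Hypothesis p_odd : odd p.
Hypothesis h_gt0 : (0 < h)%N.
Hypothesis alt : alternating_form om.
Hypothesis nondeg : nondegenerate_form om.
Variable R : realType.

Lemma two_neq0 : 2%:R != 0 :> 'F_p.
Proof.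
have p2 : (2 < p)%N by move: (prime_gt1 p_prime) p_odd; case: p => // [[|[|[]]]].
have cp : p \in [pchar 'F_p] by apply: pchar_Fp.
by rewrite -(dvdn_pcharf cp) gtnNdvd.
Qed.

Section Local.
Variables (B : pred 'I_r) (t : tuples p h r).
Hypothesis sp : spans B t.
Variable f : heis p h -> R.
Hypothesis f0 : forall x, 0 <= f x.

Let S := \sum_(j | B j) \sum_s gain (heis_act om s (t j)) f.

Let g0 j s : 0 <= gain (heis_act om s (t j)) f.
Proof. by apply: gain_ge0 => //; apply: heis_act_resampling. Qed.

(** Otherwise the functional [om *m w^T] vanishes on a spanning family, which puts [w] in the
    radical of the form. *)
Lemma spans_pairing w : w != 0 -> exists2 j, B j & Defs.form om w (t j).1 != 0.
Proof.
move=> w0; apply/exists_inP; rewrite -[X in is_true X]negbK negb_exists_in; apply/negP => /forall_inP H.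
case/negP: w0; apply/eqP; apply: nondeg => v; rewrite (form_skew alt).
suff hu : om *m w^T = 0 by rewrite /Defs.form -mulmxA hu mulmx0 mxE oppr0.
apply: (spansP _ _ sp) => j Bj; apply/matrixP => a b; rewrite !ord1 [RHS]mxE mulmxA.
by have := H j Bj; rewrite negbK (form_skew alt) oppr_eq0 => /eqP.
Qed.

(** Every [w != 0] pairs nontrivially with some row of the block, whose conjugation gain contains
    the deficit of the fibre over [w]. *)
Lemma sum_zdeficit_neq0 : \sum_(w | w != 0) zdeficit f w <= S.
Proof.
apply: (@le_trans _ _ (\sum_(j | B j) \sum_(w | Defs.form om w (t j).1 != 0) zdeficit f w)); last first.
  apply: ler_sum => j _; rewrite -gain_zconj // ; apply: gain_zconj_le => //; exact: two_neq0.
rewrite [leRHS](exchange_big_dep xpredT) //= big_mkcond; apply: ler_sum => w _.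
case: ifPn => [w0|_]; last by apply: sumr_ge0 => j _; apply: zdeficit_ge0.
have [j Bj wj] := spans_pairing w0.
rewrite (bigD1 j) /= ?Bj // lerDl; apply: sumr_ge0 => k _; exact: zdeficit_ge0.
Qed.

(** Once the centre is averaged, only a function on [W] remains. There multiplication by [t j] is a
    translation, translations commute, and those of a spanning family act transitively. *)
Lemma deficit_avg_zshift : deficit (avg (zshift (h := h)) f) <= S.
Proof.
set F := avg _ f.
have rz := @zshift_resampling p h R.
have F0 x : 0 <= F x by apply: avg_ge0.
have Fz a x : F (zshift a x) = F x by apply: avg_invariant.
apply: (@le_trans _ _ (\sum_(j <- enum B) gain (wshift (t j).1) F)).
  have rw j : resampling R (wshift (t j).1) by apply: wshift_resampling.
  have cw i j a b (x : heis p h) : i != j -> wshift (t i).1 a (wshift (t j).1 b x) = wshift (t j).1 b (wshift (t i).1 a x).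
    by move=> _; rewrite wshiftC.
  apply: deficit_avgs => // x y.
  set G := avgs _ _ _.
  have Gw j a u : B j -> G (wshift (t j).1 a u) = G u.
    by move=> Bj; apply: avgs_invariant => //; rewrite mem_enum.
  have Gz a u : G (zshift a u) = G u.
    rewrite /G; elim: (enum B) u => [|j l IH] u /=; first exact: Fz.
    rewrite /avg; congr (_ * _); apply: eq_bigr => b _.
    by rewrite -zshift_wshift IH.
  have [c e] := spans_combination sp (y.1 - x.1).
  have Gv w z : G (w + (y.1 - x.1), z) = G (w, z).
    rewrite e; elim/big_rec: _ w => [|j v Bj IH] w; first by rewrite addr0.
    by rewrite addrA IH -(Gw j (c j) (w, z) Bj).
  case: x y Gv {e} => [v z] [w z'] /= Gv.
  by rewrite -(Gv v z) addrC subrK -(Gz (z' - z)) /zshift /= addrC subrK.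
rewrite big_enum; apply: ler_sum => j Bj.
have rh s := @heis_act_resampling p h om alt R s (t j).
have -> : gain (wshift (t j).1) F = gain (heis_act om true (t j)) F.
  rewrite /gain; congr (_ - entropy _); apply: funext => x; rewrite /avg; congr (_ * _).
  by apply: eq_bigr => a _; rewrite heis_act_wshift Fz.
rewrite big_bool /=; apply: (@le_trans _ _ (gain (heis_act om true (t j)) f)); last by rewrite lerDl.
apply: gain_avg => //; apply: avg_comm => a b x; exact: zshift_heis_act.
Qed.

(** Conjugation fixes central points, so the fibre over 0 is compared with that over
    [v = (t k).1 != 0]: [(0, z)] and [(v, z + (t k).2)] lie in one coset of the powers of [t k], and
    right averaging gives them a common value, close to both in Hellinger distance. *)
Lemma zdeficit0_le : zdeficit f 0 <= 48 * p%:R * S.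
Proof.
have [k Bk tk] : exists2 k, B k & (t k).1 != 0.
  apply/exists_inP; rewrite -[X in is_true X]negbK negb_exists_in; apply/negP => /forall_inP H.
  have hu j : B j -> (t j).1 *m (const_mx 1 : 'cV['F_p]_h) = 0.
    by move=> Bj; have := H j Bj; rewrite negbK => /eqP ->; rewrite mul0mx.
  have /matrixP/(_ (Ordinal h_gt0) 0) := spansP _ _ sp _ hu.
  by rewrite !mxE => /eqP; rewrite oner_eq0.
set v := (t k).1 in tk; set T := avg (heis_act om true (t k)) f.
have rT := @heis_act_resampling p h om alt R true (t k).
pose a (z : 'F_p) := f (0, z); pose b (z : 'F_p) := f (v, z + (t k).2).
have Tab (z : 'F_p) : T (v, z + (t k).2) = T (0, z).
  rewrite /T -(avg_invariant rT f 1 (0, z)); congr (avg _ _ _).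
  by rewrite /heis_act /= scale1r add0r /Defs.form !mul0mx mxE mulr0 addr0 mul1r.
have gS : \sum_s gain (heis_act om s (t k)) f <= S.
  rewrite /S (bigD1 k) //= lerDl; apply: sumr_ge0 => j _; exact: sumr_ge0.
have bS : deficit b <= S.
  apply: le_trans sum_zdeficit_neq0; rewrite (bigD1 v) //=.
  have -> : deficit b = zdeficit f v.
    rewrite /zdeficit !deficitE.
    have e : \sum_y b y = \sum_(z : 'F_p) f (v, z) by rewrite [RHS](reindex_inj (addIr (t k).2)).
    by rewrite e [RHS](reindex_inj (addIr (t k).2)).
  by rewrite lerDl; apply: sumr_ge0 => w _; apply: zdeficit_ge0.
have hT : \sum_z (Num.sqrt (a z) - Num.sqrt (T (0, z))) ^+ 2 +
    \sum_z (Num.sqrt (b z) - Num.sqrt (T (0, z))) ^+ 2 <= S.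
  apply: (le_trans _ gS); rewrite big_bool /=; apply: (@le_trans _ _ (gain (heis_act om true (t k)) f)); last by rewrite lerDl.
  apply: le_trans (gain_hellinger rT f0); rewrite sum_heis [leRHS](bigD1 (0 : W)) //= lerD2l [leRHS](bigD1 v) //=.
  rewrite [X in _ <= X + _](reindex_inj (addIr (t k).2)) /=.
  rewrite [X in X <= _](eq_bigr (fun z => (Num.sqrt (b z) - Num.sqrt (T (v, z + (t k).2))) ^+ 2)) => [|z _]; last by rewrite Tab.
  by rewrite lerDl; apply: sumr_ge0 => w _; apply: sumr_ge0 => z _; apply: sqr_ge0.
pose c := Num.sqrt ((\sum_z b z) / #|'F_p|%:R).
have h1 : \sum_z (Num.sqrt (b z) - c) ^+ 2 <= deficit b by apply: hellinger_le_deficit => z; apply: f0.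
have h2 : deficit a <= 8 * p%:R * \sum_z (Num.sqrt (a z) - c) ^+ 2.
  by have := @deficit_le_hellinger R 'F_p a c; rewrite card_Fp //; apply => z; apply: f0.
apply: (le_trans h2); have -> : 48 * p%:R * S = 8 * p%:R * (6 * S) by ring.
rewrite ler_wpM2l ?mulr_ge0 ?ler0n //.
(* Two triangle inequalities for squares, through [b] and then through the common average, give
   [4 S + 2 S]. *)
apply: (@le_trans _ _ (4 * (\sum_z (Num.sqrt (a z) - Num.sqrt (T (0, z))) ^+ 2 +
    \sum_z (Num.sqrt (b z) - Num.sqrt (T (0, z))) ^+ 2) + 2 * \sum_z (Num.sqrt (b z) - c) ^+ 2)); last by lra.
rewrite -big_split !mulr_sumr -big_split; apply: ler_sum => z _ /=.
move: (Num.sqrt (a z)) (Num.sqrt (b z)) (Num.sqrt (T (0, z))) => x y s.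
have := sqr_ge0 (x + c - 2 * y); have := sqr_ge0 (x + y - 2 * s).
have -> : (x - c) ^+ 2 = 2 * (x - y) ^+ 2 + 2 * (y - c) ^+ 2 - (x + c - 2 * y) ^+ 2 by ring.
have -> : (x - y) ^+ 2 = 2 * (x - s) ^+ 2 + 2 * (y - s) ^+ 2 - (x + y - 2 * s) ^+ 2 by ring.
lra.
Qed.

(** Chain rule along the centre: the fibres over [w != 0] cost [S], the quotient [W] costs [S], and
    the fibre over 0 costs [48 p S]. *)
Lemma deficit_heis_le : deficit f <= 50 * p%:R * S.
Proof.
have -> : deficit f = gain (zshift (h := h)) f + deficit (avg (zshift (h := h)) f).
  by rewrite /deficit /gain flat_avg; [ring|exact: zshift_resampling].
rewrite gain_zshift (bigD1 0) //=.
have S0 : 0 <= S by apply: sumr_ge0 => j _; apply: sumr_ge0.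
have h1 := sum_zdeficit_neq0; have h2 := deficit_avg_zshift; have h3 := zdeficit0_le.
have p1 : 1 <= p%:R :> R by rewrite ler1n prime_gt0.
have := ler_wpM2r S0 p1; lra.
Qed.

End Local.
End Spanning.

(** * Support growth for one column *)

Lemma bernoulli (R : realType) (u : R) n : -1 <= u -> 1 + n%:R * u <= (1 + u) ^+ n.
Proof.
move=> u1; elim: n => [|n IH]; first by rewrite mul0r addr0 expr0.
rewrite exprS; apply: (@le_trans _ _ ((1 + u) * (1 + n%:R * u))); last first.
  by rewrite ler_wpM2l // -lerBlDl sub0r.
have : 0 <= n%:R * (u * u) by rewrite mulr_ge0 ?ler0n // -expr2 sqr_ge0.
rewrite -natr1; lra.
Qed.

Lemma expr_expR_le (R : realType) (u : R) n : u <= 1 -> (1 - u) ^+ n <= expR (- (n%:R * u)).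
Proof.
move=> u1; rewrite -mulrN expRM_natl lerXn2r ?nnegrE ?expR_ge0 ?subr_ge0 //.
by have := expR_ge1Dx (- u).
Qed.

Lemma expR_expr_le (R : realType) (u : R) n : 0 <= u -> u <= 2^-1 -> expR (- (n%:R * (2 * u))) <= (1 - u) ^+ n.
Proof.
move=> u0 u1; rewrite -mulrN expRM_natl lerXn2r ?nnegrE ?expR_ge0 ?subr_ge0 //; first by lra.
rewrite expRN -[leLHS]mul1r ler_pdivrMr ?expR_gt0 //.
have h : 1 - u >= 0 by lra.
have := ler_wpM2l h (expR_ge1Dx (2 * u)); have := mulr_ge0 u0 (_ : 0 <= 1 - 2 * u); rewrite subr_ge0.
have -> : 2 * u <= 1 by lra.
move=> /(_ isT); lra.
Qed.

Section Column.
Variables (R : realType) (p r : nat).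
Hypothesis p_prime : prime p.
Hypothesis p_gt2 : (2 < p)%N.
Hypothesis r_gt1 : (1 < r)%N.

(** Left and right moves coincide here; [s] is kept so that the column walk is an instance of the
    abstract one. *)
Definition column_act (s : bool) (t a x : 'F_p) : 'F_p := x + a * t.

Local Notation config := {ffun 'I_r -> 'F_p}.
Implicit Types (y : config).
Local Notation Q := (Qop (R := R) (r := r) column_act).
Local Notation Qt := (Qit (R := R) (r := r) column_act).

Lemma column_act_resampling s t : resampling R (column_act s t).
Proof.
by apply: action_resampling => [x|a b x]; rewrite /column_act ?mul0r ?addr0 // mulrDl -addrA [b * t + _]addrC.
Qed.

Lemma cardFp_gt0 : (0 < #|'F_p|)%N.
Proof. by rewrite card_Fp // prime_gt0. Qed.

Let rs := column_act_resampling.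
Let c0 := cardFp_gt0.

Definition support_size y := #|[set k | y k != 0]|.

Definition zero_config : config := [ffun=> 0].

Lemma zero_fix k a : repl column_act k.1.1 k.1.2 k.2 a zero_config = zero_config.
Proof. by apply/ffunP => i; rewrite /repl /upd /column_act !ffunE mulr0 addr0; case: eqP. Qed.

Lemma support_gt0 y : y != zero_config -> (0 < support_size y)%N.
Proof.
move=> y0; apply/card_gt0P; apply/existsP; rewrite -[X in is_true X]negbK negb_exists.
apply/negP => /forallP H; case/negP: y0; apply/eqP/ffunP => k; rewrite ffunE.
by have := H k; rewrite inE negbK => /eqP.
Qed.

Lemma support_upd i c y :
  support_size (upd i c y) = ((c != 0%R) + #|[set k | (k != i) && (y k != 0%R)]|)%N.
Proof.
rewrite /support_size (cardsD1 i) inE upd_at; congr (_ + _)%N.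
by apply: eq_card => k; rewrite !inE; case: (eqVneq k i) => //= ki; rewrite upd_other.
Qed.

Lemma support_split i y :
  support_size y = ((y i != 0%R) + #|[set k | (k != i) && (y k != 0%R)]|)%N.
Proof. by rewrite -[in LHS](upd_id i y) support_upd. Qed.

Section Lyapunov.
Variable x : R.
Hypothesis x34 : 3 / 4 <= x.
Hypothesis x1 : x <= 1.

Let x0 : 0 < x. Proof. by apply: lt_le_trans x34; rewrite divr_gt0. Qed.

Definition lyap y : R := x ^+ support_size y.

Lemma lyap_ge0 y : 0 <= lyap y. Proof. by rewrite exprn_ge0 // ltW. Qed.

Let p3 : (p%:R : R)^-1 <= 3^-1.
Proof. by rewrite lef_pV2 ?posrE ?ltr0n ?ler_nat // prime_gt0. Qed.

Lemma avg_lyap_0 i j s y : y j = 0 -> avg (repl column_act i j s) lyap y = lyap y.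
Proof.
move=> yj; have cF : #|'F_p|%:R != 0 :> R by rewrite pnatr_eq0 -lt0n.
rewrite /avg (eq_bigr (fun=> lyap y)) => [|a _].
  by rewrite sumr_const -[lyap y *+ _]mulr_natl mulKf.
by rewrite /repl /column_act yj mulr0 addr0 upd_id.
Qed.

Lemma sum_lyap_upd i y : \sum_c lyap (upd i c y) =
  x ^+ #|[set k | (k != i) && (y k != 0)]| * (1 + (p%:R - 1) * x).
Proof.
rewrite (bigD1 0) //= /lyap support_upd eqxx add0n.
rewrite (eq_bigr (fun=> x ^+ #|[set k | (k != i) && (y k != 0)]| * x)) => [|c c0'].
  rewrite sumr_const cardC1 card_Fp // -[_ *+ _]mulr_natr -subn1 natrB ?prime_gt0 //; ring.
by rewrite support_upd c0' add1n exprSr.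
Qed.

(** A nonzero neighbour makes coordinate [i] uniform. A nonzero entry then dies with probability
    [1/p <= 1/3], costing [(1 - x) / (3 x)] with [x >= 3/4]; a zero entry becomes nonzero with
    probability at least [2/3]. *)
Lemma avg_lyap_neq0 i j s y : y j != 0 ->
  avg (repl column_act i j s) lyap y <= lyap y * (1 + (1 - x) * (if y i != 0 then 4 / 9 else - (2 / 3))).
Proof.
move=> yj; have -> : avg (repl column_act i j s) lyap y = p%:R^-1 * \sum_c lyap (upd i c y).
  rewrite /avg card_Fp //; congr (_ * _); rewrite [RHS](reindex_inj (addrI (y i))) /=.
  by rewrite [RHS](reindex_inj (mulIf yj)).
have p0 : 0 < p%:R :> R by rewrite ltr0n prime_gt0.
rewrite sum_lyap_upd /lyap (support_split i y) mulrCA.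
set n := #|_|; have xn : 0 < x ^+ n by rewrite exprn_gt0.
have -> : p%:R^-1 * (1 + (p%:R - 1) * x) = x + p%:R^-1 * (1 - x) by field; rewrite gt_eqF.
have q0 : 0 < (p%:R : R)^-1 by rewrite invr_gt0.
case: ifP => /= _; rewrite ?add0n ?add1n ?exprS ?[x * _]mulrC -?mulrA; apply: ler_wpM2l; rewrite ?(ltW xn) //.
  have : p%:R^-1 * (1 - x) <= 3^-1 * (1 - x) by rewrite ler_wpM2r // subr_ge0.
  have : 0 <= (1 - x) * (x - 3 / 4) by rewrite mulr_ge0 // subr_ge0.
  lra.
have : p%:R^-1 * (1 - x) <= 3^-1 * (1 - x) by rewrite ler_wpM2r // subr_ge0.
lra.
Qed.

Let nm0 : 0 < nmoves R r.
Proof. by rewrite /nmoves ltr0n; move: r_gt1; nia. Qed.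

Let nmE : nmoves R r = 2 * r%:R * (r%:R - 1).
Proof. by rewrite /nmoves !natrM natrB // ltnW. Qed.

Lemma sum_supp (F : R) y : \sum_(i | y i != 0) F = (support_size y)%:R * F.
Proof.
rewrite sumr_const -[_ *+ _]mulr_natl; congr (_%:R * _).
by rewrite /support_size cardsE.
Qed.

Lemma sum_nsupp (F : R) y : \sum_(i | y i == 0) F = (r%:R - (support_size y)%:R) * F.
Proof.
have : \sum_(i : 'I_r) F = r%:R * F by rewrite sumr_const card_ord -[_ *+ _]mulr_natl.
rewrite (bigID (fun i => y i != 0)) /= sum_supp => e.
under eq_bigl do rewrite -[_ == 0]negbK.
rewrite mulrBl -e; ring.
Qed.

(** With [N] the support size, [N (N - 1)] ordered pairs lie inside the support and [N (r - N)] lead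
    from it to a zero entry; all other pairs do nothing. *)
Lemma Qop_lyap_bound y : Q lyap y <= lyap y * (1 + (1 - x) / (2 * r%:R * (r%:R - 1)) *
   ((4 / 9) * (support_size y)%:R * ((support_size y)%:R - 1) -
    (2 / 3) * (support_size y)%:R * (r%:R - (support_size y)%:R))).
Proof.
set N : R := (support_size y)%:R.
pose e i j : R := if y j != 0 then (if y i != 0 then 4 / 9 else - (2 / 3)) else 0.
have h : \sum_(k | dist_move k) avg_move column_act k lyap y <=
   \sum_i \sum_(j | j != i) \sum_(s : bool) lyap y * (1 + (1 - x) * e i j).
  rewrite /avg_move (sum_moves (fun i j s => avg (repl column_act i j s) lyap y)).
  apply: ler_sum => i _; apply: ler_sum => j _; apply: ler_sum => s _.
  rewrite /e; case: ifP => [yj|/negbFE/eqP yj]; first exact: avg_lyap_neq0.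
  by rewrite avg_lyap_0 // mulr0 addr0 mulr1.
have hi i : \sum_(j | j != i) \sum_(s : bool) lyap y * (1 + (1 - x) * e i j) =
    2 * lyap y * ((r%:R - 1) + (1 - x) * (if y i != 0 then 4 / 9 * (N - 1) else - (2 / 3) * N)).
  pose E : R := if y i != 0 then 4 / 9 else - (2 / 3).
  rewrite (eq_bigr (fun j => 2 * lyap y * 1 + 2 * lyap y * (1 - x) * e i j)) => [|j _]; last by rewrite big_bool /=; ring.
  rewrite big_split /= -!mulr_sumr.
  have -> : \sum_(j | j != i) (1 : R) = r%:R - 1.
    have : \sum_(j : 'I_r) (1 : R) = r%:R by rewrite sumr_const card_ord.
    by rewrite (bigD1 i) //= => <-; ring.
  have -> : \sum_(j | j != i) e i j = N * E - (if y i != 0 then E else 0).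
    rewrite -(sum_supp E) [in RHS]big_mkcond [in RHS](bigD1 i) //= addrAC subrr add0r.
    by apply: eq_bigr.
  by rewrite /E; case: ifP => _; ring.
have hs : \sum_i \sum_(j | j != i) \sum_(s : bool) lyap y * (1 + (1 - x) * e i j) =
   lyap y * (nmoves R r + 2 * (1 - x) * ((4 / 9) * N * (N - 1) - (2 / 3) * N * (r%:R - N))).
  under eq_bigr do rewrite hi; rewrite -mulr_sumr big_split /= -mulr_sumr sumr_const card_ord.
  rewrite (bigID (fun i => y i != 0)) /=.
  rewrite (eq_bigr (fun=> 4 / 9 * (N - 1))) => [|i ->//].
  rewrite [X in (1 - x) * (_ + X)](eq_bigr (fun=> - (2 / 3) * N)) => [|i /negbTE->//].
  rewrite [X in (1 - x) * (_ + X)](eq_bigl (fun i => y i == 0)) => [|i]; last by rewrite negbK.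
  by rewrite sum_supp sum_nsupp nmE -/N -[_ *+ r]mulr_natr; ring.
rewrite hs in h; have i0 : 0 <= (nmoves R r)^-1 by rewrite invr_ge0 ltW.
have := ler_wpM2l i0 h; rewrite /Qop => {}h.
apply: (@le_trans _ _ (2^-1 * (lyap y + (nmoves R r)^-1 * (lyap y *
       (nmoves R r + 2 * (1 - x) * (4 / 9 * N * (N - 1) - 2 / 3 * N * (r%:R - N))))))).
  by rewrite ler_wpM2l ?invr_ge0 // lerD2l.
rewrite le_eqVlt; apply/orP; left; apply/eqP; rewrite nmE; field.
by rewrite subr_eq0 (eqr_nat R r 1) pnatr_eq0; move: r_gt1; case: r => [|[]].
Qed.

Lemma Qop_lyap_small y : (2 * support_size y <= r)%N ->
  Q lyap y <= lyap y * (1 - (support_size y)%:R * ((1 - x) / (18 * r%:R))).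
Proof.
move=> Nr; apply: (le_trans (Qop_lyap_bound y)); rewrite ler_wpM2l ?lyap_ge0 // lerD2l.
set N : R := (support_size y)%:R; have N0 : 0 <= N by rewrite ler0n.
have {}Nr : 2 * N <= r%:R by rewrite -natrM ler_nat.
have r1 : 1 < r%:R :> R by rewrite ltr1n.
have r0 : 0 < r%:R :> R by lra.
(* For [N <= r / 2], [10/9 N <= 5/9 r] against [6/9 r] leaves the drift [- r / 9] per support
   element. *)
have h : 4 / 9 * N * (N - 1) - 2 / 3 * N * (r%:R - N) <= - (N * (r%:R - 1) / 9).
  have := mulr_ge0 N0 (_ : 0 <= r%:R - 2 * N); rewrite subr_ge0 => /(_ Nr); lra.
have i0 : 0 <= (1 - x) / (2 * r%:R * (r%:R - 1)).
  by rewrite divr_ge0 ?subr_ge0 // !mulr_ge0 ?ler0n // subr_ge0 ltW.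
have := ler_wpM2l i0 h; move=> /le_trans; apply.
rewrite le_eqVlt; apply/orP; left; apply/eqP; field.
by rewrite gt_eqF // gt_eqF // subr_gt0.
Qed.

(** Beyond half support [lyap] is already at most [x ^+ r./2], and one step at most doubles it. *)
Lemma Qop_lyap_large y : (r < 2 * support_size y)%N -> Q lyap y <= 2 * x ^+ r./2.
Proof.
move=> Nr; apply: (le_trans (Qop_lyap_bound y)).
have xN : lyap y <= x ^+ r./2.
  by rewrite /lyap; apply: ler_wiXn2l; rewrite ?(ltW x0) //; lia.
set N : R := (support_size y)%:R; have N0 : 0 <= N by rewrite ler0n.
have Nle : N <= r%:R.
  by rewrite ler_nat /support_size; apply: leq_trans (max_card _) _; rewrite card_ord.
have r1 : 1 < r%:R :> R by rewrite ltr1n.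
have r0 : 0 < r%:R :> R by lra.
apply: (@le_trans _ _ (lyap y * 2)); last by rewrite mulrC ler_wpM2l.
rewrite ler_wpM2l ?lyap_ge0 //.
have h : 4 / 9 * N * (N - 1) - 2 / 3 * N * (r%:R - N) <= r%:R * (r%:R - 1).
  have : 0 <= N * (r%:R - N) by rewrite mulr_ge0 // subr_ge0.
  have : 0 <= (r%:R - 1) * (r%:R - N) by rewrite mulr_ge0 ?subr_ge0 // ltW.
  have : (0 : R) <= r%:R * (r%:R - 1) by rewrite mulr_ge0 ?subr_ge0 // ltW.
  lra.
have i0 : 0 <= (1 - x) / (2 * r%:R * (r%:R - 1)).
  by rewrite divr_ge0 ?subr_ge0 // !mulr_ge0 ?ler0n // subr_ge0 ltW.
have := ler_wpM2l i0 h.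
have -> : (1 - x) / (2 * r%:R * (r%:R - 1)) * (r%:R * (r%:R - 1)) = (1 - x) / 2.
  by field; rewrite !gt_eqF // subr_gt0.
have := x0; lra.
Qed.

Let beta := (1 - x) / (18 * r%:R).

Let beta0 : 0 <= beta.
Proof. by rewrite divr_ge0 ?subr_ge0 // mulr_ge0 ?ler0n. Qed.

Let beta1 : beta <= 1.
Proof.
have r1 : 1 < r%:R :> R by rewrite ltr1n.
by rewrite ler_pdivrMr; have := x0; lra.
Qed.

(** By Bernoulli [1 - N beta <= (1 - beta)^N], so a step can be read as lowering the base from [x]
    to [x (1 - beta)]. *)
Lemma Qop_lyap_le y : Q lyap y <= (x * (1 - beta)) ^+ support_size y + 2 * x ^+ r./2.
Proof.
have x0' := x0; have [Nr|Nr] := leqP (2 * support_size y) r.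
  apply: (le_trans (Qop_lyap_small Nr)).
  rewrite -[leLHS]addr0; apply: lerD; last by rewrite mulr_ge0 // exprn_ge0 // ltW.
  rewrite exprMn; apply: ler_wpM2l; first exact: lyap_ge0.
  by rewrite -mulrN; apply: bernoulli; rewrite lerN2; exact: beta1.
apply: (le_trans (Qop_lyap_large Nr)); rewrite lerDr exprn_ge0 // mulr_ge0 ?subr_ge0 //.
exact: ltW.
Qed.

Lemma Qop_lyap_decay y : y != zero_config ->
  Q lyap y <= (1 - beta) * lyap y + 2 * x ^+ r./2.
Proof.
have x0' := x0; move=> y0; have b1 : 0 <= 1 - beta by rewrite subr_ge0.
have [Nr|Nr] := leqP (2 * support_size y) r.
  apply: (le_trans (Qop_lyap_small Nr)).
  rewrite -[leLHS]addr0; apply: lerD; last by rewrite mulr_ge0 // exprn_ge0 // ltW.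
  rewrite mulrC ler_wpM2r ?lyap_ge0 // lerD2l lerN2 -/beta.
  by rewrite ler_peMl // ler1n support_gt0.
apply: (le_trans (Qop_lyap_large Nr)); rewrite lerDr mulr_ge0 ?lyap_ge0 //.
Qed.

(** The zero configuration, which violates the one-step decay, is never reached from [y]; off it the
    support has at least one element and the factor is at most [1 - beta]. *)
Lemma Qit_lyap_decay t y : y != zero_config ->
  Qt t lyap y <= (1 - beta) ^+ t + t%:R * (2 * x ^+ r./2).
Proof.
have x0' := x0; have b1 : 0 <= 1 - beta by rewrite subr_ge0.
set e := 2 * _; have e0 : 0 <= e by rewrite mulr_ge0 // exprn_ge0 // ltW.
move=> y0; suff : Qt t lyap y <= (1 - beta) ^+ t * lyap y + t%:R * e.
  move=> /le_trans; apply; rewrite lerD2r ler_piMr ?exprn_ge0 //.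
  by rewrite /lyap exprn_ile1 // ltW.
elim: t => [|t IH]; first by rewrite expr0 mul1r mul0r addr0.
rewrite -[t.+1]addn1 Qit_add.
have h g : g != zero_config -> Qt 1 lyap g <= (1 - beta) * lyap g + e by apply: Qop_lyap_decay.
have := @Qit_mono_off R r _ _ column_act rs c0 r_gt1 _ zero_fix t _ _ h y y0.
rewrite (Qit_addc rs c0 r_gt1 t (fun g => (1 - beta) * lyap g)) (Qit_scale rs c0 t lyap) => /le_trans; apply.
have := ler_wpM2l b1 IH; rewrite exprD expr1 natrD => h1.
have : 0 <= beta * (t%:R * e) by rewrite mulr_ge0 // mulr_ge0 // ler0n.
move: h1; move: ((1 - beta) ^+ t) (Qt t lyap y) (lyap y) => a b c.
move: beta (t%:R : R) => B n h1 h2; lra.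
Qed.

End Lyapunov.

Lemma lyap_mono x x' y : 0 <= x -> x <= x' -> lyap x y <= lyap x' y.
Proof. by move=> x0 xx; rewrite /lyap lerXn2r ?nnegrE // (le_trans x0). Qed.

(* The base of the Lyapunov function decreases along the backward iteration: early on the support may be tiny, but a small base is then affordable. *)
Definition base_step (x : R) := Num.max (3 / 4) (x * (1 - (1 - x) / (18 * r%:R))).
Definition base_seq (x : R) k := iter k base_step x.

Section BaseSeq.
Variable x : R.
Hypothesis x34 : 3 / 4 <= x.
Hypothesis x1 : x <= 1.

Lemma base_step_bounds u : 3 / 4 <= u -> u <= 1 -> 3 / 4 <= base_step u <= u.
Proof.
move=> u34 u1; rewrite /base_step le_max lexx /= ge_max u34 /=.
have u0 : 0 <= u by apply: le_trans u34; rewrite divr_ge0.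
by rewrite ler_piMr // gerBl divr_ge0 ?subr_ge0 // mulr_ge0 ?ler0n.
Qed.

Lemma base_seq_bounds k : 3 / 4 <= base_seq x k <= x.
Proof.
elim: k => [|k /andP[IH1 IH2]]; first by rewrite /= x34 lexx.
have /andP[h1 h2] := base_step_bounds IH1 (le_trans IH2 x1).
by rewrite /= h1 (le_trans h2).
Qed.

Lemma Qit_lyap_shift s y :
  Qt s (lyap x) y <= lyap (base_seq x s) y + s%:R * (2 * x ^+ r./2).
Proof.
set e := 2 * _; elim: s y => [|s IH] y; first by rewrite mul0r addr0.
have /andP[h1 h2] := base_seq_bounds s; set u := base_seq x s in IH h1 h2 *.
have u1 := le_trans h2 x1.
have u0 : 0 <= u by apply: le_trans h1; rewrite divr_ge0.
have := @Qit_mono R r _ _ column_act rs c0 r_gt1 1 _ _ IH y.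
rewrite (Qit_addc rs c0 r_gt1 1 (lyap u)) => /le_trans; apply.
rewrite /= -/u -natr1; have := Qop_lyap_le h1 u1 y.
have : (u * (1 - (1 - u) / (18 * r%:R))) ^+ support_size y <= lyap (base_step u) y.
  apply: lyap_mono; last by rewrite /base_step le_max lexx orbT.
  rewrite mulr_ge0 // subr_ge0 ler_pdivrMr; last by rewrite mulr_gt0 ?ltr0n // ltnW.
  have : 1 <= r%:R :> R by rewrite ler1n ltnW.
  by rewrite mul1r; lra.
have : 2 * u ^+ r./2 <= e by rewrite /e ler_wpM2l // lerXn2r ?nnegrE // (le_trans u0).
by rewrite /= /lyap; lra.
Qed.

(** The gap [1 - u] is multiplied by [1 + u / (18 r)], at least [1 + 1 / (24 r)] since [u >= 3/4],
    until it reaches [1/4]. *)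
Lemma base_seq_gap k : Num.min (1 / 4) ((1 - x) * (1 + (24 * r%:R)^-1) ^+ k) <= 1 - base_seq x k.
Proof.
have r0 : 0 < r%:R :> R by rewrite ltr0n ltnW.
elim: k => [|k IH]; first by rewrite /= expr0 mulr1 ge_min lexx orbT.
have /andP[h1 h2] := base_seq_bounds k; rewrite /=; set u := base_seq x k in IH h1 h2 *.
have u1 := le_trans h2 x1.
set d := (24 * r%:R)^-1; have d0 : 0 <= d by rewrite invr_ge0 mulr_ge0 // ltW.
have key : (1 - u) * (1 + d) <= 1 - u * (1 - (1 - u) / (18 * r%:R)).
  have -> : 1 - u * (1 - (1 - u) / (18 * r%:R)) = (1 - u) * (1 + 4 / 3 * u * d).
    by rewrite /d; field; rewrite gt_eqF.
  rewrite ler_wpM2l ?subr_ge0 // lerD2l ler_peMl //; lra.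
rewrite /base_step; case: (leP (3 / 4) (u * (1 - (1 - u) / (18 * r%:R)))) => h; last first.
  by rewrite ge_min; apply/orP; left; lra.
apply: le_trans key; rewrite exprSr mulrA.
move: IH; rewrite !ge_min => /orP[IH|IH]; apply/orP.
  by left; apply: (le_trans IH); rewrite ler_peMr ?subr_ge0 // lerDl.
by right; rewrite ler_wpM2r // addr_ge0.
Qed.

(** By Bernoulli the gap doubles every [24 r] steps; [l] doublings bring it from [1 / (4 r)] to
    [1/4]. *)
Lemma base_seq_hit l : (r <= 2 ^ l)%N -> 1 <= 4 * (1 - x) * r%:R ->
  base_seq x (24 * r * l) = 3 / 4.
Proof.
move=> rl h; have r0 : 0 < r%:R :> R by rewrite ltr0n ltnW.
have /andP[h1 h2] := base_seq_bounds (24 * r * l).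
apply/eqP; rewrite eq_le h1 andbT.
have := base_seq_gap (24 * r * l); rewrite ge_min => /orP[|]; first lra.
have : 2 ^+ l <= (1 + (24 * r%:R)^-1) ^+ (24 * r * l) :> R.
  rewrite exprM lerXn2r ?nnegrE ?exprn_ge0 ?addr_ge0 ?invr_ge0 ?mulr_ge0 ?ler0n //.
  set d := (24 * r%:R)^-1; have d0 : 0 <= d by rewrite invr_ge0 mulr_ge0 // ltW.
  apply: le_trans (bernoulli (24 * r) (_ : -1 <= d)); last by apply: le_trans d0; rewrite oppr_le0.
  by rewrite /d natrM mulfV ?mulf_neq0 ?gt_eqF // ltr0n ltnW.
have : r%:R <= 2 ^+ l :> R by rewrite -natrX ler_nat.
move=> e1 e2 e3; have : (1 - x) * r%:R <= (1 - x) * (1 + (24 * r%:R)^-1) ^+ (24 * r * l).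
  by rewrite ler_wpM2l ?subr_ge0 // (le_trans e1).
lra.
Qed.

End BaseSeq.
End Column.

Lemma relax_iterate (R : realType) (D : nat -> R) (gamma B : R) n :
  0 <= gamma -> gamma <= 1 -> 0 <= B ->
  (forall k, (k < n)%N -> D k.+1 <= D k - gamma * (D k - B)) ->
  D n <= (1 - gamma) ^+ n * D 0%N + B.
Proof.
move=> g0 g1 B0; elim: n => [|n IH] h; first by rewrite expr0 mul1r lerDl.
have {}IH := IH (fun k kn => h k (ltnW kn)).
have g1' : 0 <= 1 - gamma by rewrite subr_ge0.
have := ler_wpM2l g1' IH; have := h n (ltnSn n).
rewrite exprS; move: ((1 - gamma) ^+ n) (D n) (D n.+1) (D 0%N) => a b c d; lra.
Qed.

(** * Small supports are unlikely *)

Section ColumnMixing.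
Variables (R : realType) (p r l : nat).
Hypothesis p_prime : prime p.
Hypothesis p_gt2 : (2 < p)%N.
Hypothesis r_gt1 : (1 < r)%N.
Hypothesis r_le : (r <= 2 ^ l)%N.
Hypothesis r_ge : (192 * l <= r)%N.

Local Notation config := {ffun 'I_r -> 'F_p}.
Implicit Types (y : config).
Local Notation Qt := (Qit (R := R) (r := r) (@column_act p)).
Local Notation zero := (zero_config p r).

Let rs := @column_act_resampling R p.
Let c0 := @cardFp_gt0 p p_prime.

Let l_gt0 : (0 < l)%N.
Proof. by case: l r_le => // /(leq_trans r_gt1). Qed.

Let l1 : 1 <= l%:R :> R.
Proof. by rewrite ler1n. Qed.

Let r192 : 192 * l%:R <= r%:R :> R.
Proof. by rewrite -natrM ler_nat. Qed.

Let r0 : 0 < r%:R :> R.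
Proof. by rewrite ltr0n ltnW. Qed.

(** Tuned so that [x ^+ q], for [q] about [r / 4], lies between [expR (- 24 l)] and [expR (- 6 l)];
    the condition [192 l <= r] keeps [x >= 3/4]. *)
Let x : R := 1 - 48 * l%:R / r%:R.

Let u48 : 48 * l%:R / r%:R <= 4^-1 :> R.
Proof. by rewrite ler_pdivrMr //; have := r192; lra. Qed.

Let u0 : 0 <= 48 * l%:R / r%:R :> R.
Proof. by rewrite divr_ge0 ?mulr_ge0. Qed.

Lemma natr_le_expR : r%:R <= expR l%:R :> R.
Proof.
apply: (@le_trans _ _ (2 ^+ l)); first by rewrite -natrX ler_nat.
rewrite -[l%:R]mulr1 expRM_natl lerXn2r ?nnegrE ?expR_ge0 //.
by have := expR_ge1Dx (1 : R); rewrite -natr1.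
Qed.

Definition small_support y : bool := (4 * support_size y <= r)%N.

(** Markov: on small supports [lyap x >= x ^+ q]. The last [24 r l] steps of the walk let the base
    drop to [3/4]; the earlier ones, at least [2160 r l], make [lyap (3/4)] decay. The errors
    [x ^+ r./2 <= x ^+ q * x ^+ q] survive division by [x ^+ q]. *)
Lemma small_support_bound y t : y != zero -> (2184 * r * l <= t)%N ->
  Qt t (fun g => (small_support g)%:R) y <= expR (- (6 * l%:R)) * (1 + 2 * t%:R).
Proof.
move=> y0 ht; set P := Qt t _ y.
have x34 : 3 / 4 <= x by rewrite /x; have := u48; lra.
have x1 : x <= 1 by rewrite /x; have := u0; lra.
have x0 : 0 < x by apply: lt_le_trans x34; rewrite divr_gt0.
pose q := (r %/ 4)%N.
have hit : base_seq r x (24 * r * l) = 3 / 4.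
  apply: (base_seq_hit r_gt1 x34 x1 r_le).
  have -> : 4 * (1 - x) * r%:R = 192 * l%:R by rewrite /x; field; rewrite gt_eqF.
  by have := l1; lra.
set s := (24 * r * l)%N in hit.
have [st st'] : (s <= t)%N /\ (2160 * (r * l) <= t - s)%N.
  by move: ht; rewrite /s -!mulnA; move: (r * l)%N => m; clear; lia.
have h34 : 3 / 4 <= 3 / 4 :> R by [].
have h341 : 3 / 4 <= 1 :> R by lra.
have b1 : Qt t (lyap x) y <= (1 - (1 - 3 / 4) / (18 * r%:R)) ^+ (t - s) +
     (t - s)%:R * (2 * (3 / 4) ^+ r./2) + s%:R * (2 * x ^+ r./2).
  have hs g := @Qit_lyap_shift R p r p_prime p_gt2 r_gt1 x x34 x1 s g; rewrite hit in hs.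
  rewrite -(subnK st) Qit_add addnK.
  apply: (le_trans (Qit_mono rs c0 r_gt1 _ hs y)).
  rewrite (Qit_addc rs c0 r_gt1 _ (lyap (3 / 4))) lerD2r.
  exact: (Qit_lyap_decay p_prime p_gt2 r_gt1 h34 h341).
have b2 : (1 - (1 - 3 / 4) / (18 * r%:R)) ^+ (t - s) <= expR (- (30 * l%:R)) :> R.
  (* The rate at base [3/4] is [1 / (72 r)], and [2160 / 72 = 30 = 24 + 6]: 24 pays for dividing by
     [x ^+ q], 6 remains. *)
  apply: (le_trans (expr_expR_le _ _)).
    rewrite ler_pdivrMr ?mulr_gt0 //; have := r192; have := l1; lra.
  rewrite ler_expR lerN2.
  have : 2160 * r%:R * l%:R <= (t - s)%:R :> R by rewrite -!natrM ler_nat -mulnA.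
  have -> : (t - s)%:R * ((1 - 3 / 4) / (18 * r%:R)) = (t - s)%:R / (72 * r%:R) :> R.
    by field; rewrite gt_eqF.
  rewrite ler_pdivlMr ?mulr_gt0 //; lra.
have b3 : (3 / 4) ^+ r./2 <= x ^+ r./2 by rewrite lerXn2r ?nnegrE ?divr_ge0 // ltW.
have b4 : x ^+ r./2 <= x ^+ q * x ^+ q.
  rewrite -exprD; apply: ler_wiXn2l; rewrite ?(ltW x0) // /q; clear; lia.
have r192' := r192; have l1' := l1.
have q1 : q%:R <= r%:R / 4 :> R.
  by rewrite ler_pdivlMr // -natrM ler_nat /q; clear; lia.
have q2 : r%:R / 8 <= q%:R :> R.
  by rewrite ler_pdivrMr // -natrM ler_nat /q; move: r_ge l_gt0; clear; lia.
have b5 : expR (- (24 * l%:R)) <= x ^+ q.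
  apply: le_trans (expR_expr_le q u0 _); last by have := u48; lra.
  rewrite ler_expR lerN2.
  have -> : q%:R * (2 * (48 * l%:R / r%:R)) = 96 * l%:R * q%:R / r%:R :> R by field; rewrite gt_eqF.
  rewrite ler_pdivrMr //; have : (0 : R) <= l%:R * (r%:R / 4 - q%:R) by rewrite mulr_ge0 ?ler0n // subr_ge0.
  lra.
have b6 : x ^+ q <= expR (- (6 * l%:R)).
  apply: (le_trans (expr_expR_le _ _)); first by have := u48; lra.
  rewrite ler_expR lerN2.
  have -> : q%:R * (48 * l%:R / r%:R) = 48 * l%:R * q%:R / r%:R :> R by field; rewrite gt_eqF.
  rewrite ler_pdivlMr //; have : (0 : R) <= l%:R * (q%:R - r%:R / 8) by rewrite mulr_ge0 ?ler0n // subr_ge0.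
  lra.
have b7 : x ^+ q * P <= Qt t (lyap x) y.
  rewrite -(Qit_scale rs c0); apply: (Qit_mono rs c0 r_gt1) => g.
  rewrite /small_support; case: leqP => h; last by rewrite mulr0 lyap_ge0 //.
  rewrite mulr1 /lyap; apply: ler_wiXn2l; rewrite ?(ltW x0) // /q; move: h; clear; lia.
set E := expR (- (6 * l%:R)) in b6 *.
have E0 : 0 <= E by apply: expR_ge0.
have X0 : 0 < x ^+ q by rewrite exprn_gt0.
rewrite -(ler_pM2l X0); apply: (le_trans b7); apply: (le_trans b1).
have e30 : expR (- (30 * l%:R)) <= x ^+ q * E.
  have -> : - (30 * l%:R) = - (24 * l%:R) + - (6 * l%:R) :> R by ring.
  by rewrite expRD ler_wpM2r.
have tt : (t - s)%:R + s%:R = t%:R :> R by rewrite -natrD subnK.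
have k1 : (t - s)%:R * (2 * (3 / 4) ^+ r./2) <= (t - s)%:R * (2 * (x ^+ q * E)) :> R.
  rewrite ler_wpM2l ?ler0n // ler_wpM2l // (le_trans b3) // (le_trans b4) // ler_wpM2l // ltW //.
have k2 : s%:R * (2 * x ^+ r./2) <= s%:R * (2 * (x ^+ q * E)) :> R.
  rewrite ler_wpM2l ?ler0n // ler_wpM2l // (le_trans b4) // ler_wpM2l // ltW //.
have -> : x ^+ q * (E * (1 + 2 * t%:R)) = x ^+ q * E * (1 + 2 * ((t - s)%:R + s%:R)) by rewrite tt mulrA.
have := lerD (lerD (le_trans b2 e30) k1) k2; move: (x ^+ q * E) => Y h.
by apply: (le_trans h); rewrite le_eqVlt; apply/orP; left; apply/eqP; ring.
Qed.

End ColumnMixing.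

(** * Mixing of one column *)

(** [2184 r l] steps for the support to grow, then [48 r l] steps of entropy decay. *)
Definition column_time (r l : nat) := (2232 * r * l)%N.

Section ColumnMixing.
Variables (R : realType) (p r l : nat).
Hypothesis p_prime : prime p.
Hypothesis p_gt2 : (2 < p)%N.
Hypothesis r_gt1 : (1 < r)%N.
Hypothesis r_le : (r <= 2 ^ l)%N.
Hypothesis r_ge : (192 * l <= r)%N.
Hypothesis r_gep : (600 * (600 * p) <= r)%N.

Local Notation config := {ffun 'I_r -> 'F_p}.
Implicit Types (y : config).
Local Notation Qt := (Qit (R := R) (r := r) (@column_act p)).
Local Notation zero := (zero_config p r).
Local Notation delta y := (@dirac_at R r 'F_p y).

Let rs := @column_act_resampling R p.
Let c0 := @cardFp_gt0 p p_prime.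
Let r0 : 0 < r%:R :> R.
Proof. by rewrite ltr0n ltnW. Qed.

Lemma gain_column_act s t (F : 'F_p -> R) : t != 0 -> gain (column_act s t) F = deficit F.
Proof.
move=> t0; rewrite /gain /deficit; congr (_ - entropy _); apply: funext => x.
rewrite /avg /flat mulrC; congr (_ / _).
by rewrite [RHS](reindex_inj (addrI x)) /= [RHS](reindex_inj (mulIf t0)).
Qed.

(** Coordinate [i] is left out so that resampling it changes nothing. *)
Definition well_supported (i : 'I_r) : pred config :=
  fun y => (r <= 8 * #|[set k | (k != i) && (y k != 0%R)]|)%N.

Lemma well_supportedPn i y : ~~ well_supported i y -> small_support y.
Proof.
rewrite /well_supported /small_support (support_split i y) -ltnNge.
have r8 : (8 <= r)%N.
  by apply: leq_trans r_gep; move: p_gt2; clear; lia.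
move: #|_| (y i != 0%R) r8 => c b; clear; case: b => /= h1 h2; rewrite ?(add0n, add1n); lia.
Qed.

Let gamma : R := (16 * (r%:R - 1))^-1.

(** One nonzero neighbour equidistributes the coordinate, so each of its two sides gains the full
    deficit; [r / 8] such neighbours give the local constant [r / 4]. *)
Lemma deficit_Qop_column (f : config -> R) : (forall y, 0 <= f y) ->
  deficit (Qop (@column_act p) f) <= deficit f - gamma * (deficit f -
     ln p%:R * (r%:R * \sum_(y | small_support y) f y)).
Proof.
move=> f0.
have k0 : 0 <= r%:R / 4 :> R by rewrite divr_ge0 ?ler0n.
have wP i x y : well_supported i (upd i x y) = well_supported i y.
  rewrite /well_supported; congr (_ <= _ * _)%N; apply: eq_card => k; rewrite !inE.
  by case: eqP => //= /eqP ki; rewrite upd_other.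
have loc i (y : config) (F : 'F_p -> R) : well_supported i y -> (forall z, 0 <= F z) ->
    r%:R / 4 * deficit F <= \sum_(j | j != i) \sum_s gain (column_act s (y j)) F.
  move=> wi F0; have D0 := deficit_ge0 F0.
  apply: (@le_trans _ _ (\sum_(j | (j != i) && (y j != 0)) 2 * deficit F)).
    rewrite sumr_const -[(2 * deficit F) *+ _]mulr_natl mulrA ler_wpM2r //.
    have : r%:R <= (8 * #|[set k | (k != i) && (y k != 0%R)]|)%N%:R :> R by rewrite ler_nat.
    by rewrite natrM cardsE; lra.
  rewrite big_mkcondr; apply: ler_sum => j _; case: ifP => [yj|_].
    by rewrite big_bool /= !gain_column_act //; lra.
  by apply: sumr_ge0 => s _; apply: gain_ge0.
apply: (le_trans (deficit_Qop rs c0 r_gt1 k0 f0 wP loc)).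
have r1 : 1 < r%:R :> R by rewrite ltr1n.
have -> : r%:R / 4 / (2 * nmoves R r) = gamma.
  by rewrite /nmoves !natrM natrB 1?ltnW // /gamma; field; rewrite !gt_eqF // subr_gt0.
have g0 : 0 <= gamma by rewrite invr_ge0 mulr_ge0 // subr_ge0 ltW.
rewrite card_Fp // lerD2l lerN2; apply: ler_wpM2l => //; rewrite lerD2l lerN2.
apply: ler_wpM2l; first by rewrite ln_ge0 // ler1n prime_gt0.
have -> : r%:R * \sum_(y | small_support y) f y = \sum_(i < r) \sum_(y | small_support y) f y.
  by rewrite sumr_const card_ord mulr_natl.
apply: ler_sum => i _; rewrite big_mkcond [leRHS]big_mkcond; apply: ler_sum => y _.
by case: ifP => [/well_supportedPn->//|_]; case: ifP.
Qed.

Local Notation T2 := (column_time r l).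

Lemma column_deficit y : y != zero -> deficit (Qt (column_time r l) (delta y)) <= 64^-1.
Proof.
move=> y0.
have d0 g : 0 <= delta y g by apply: dirac_ge0.
set T1 := (2184 * r * l)%N; set n := (48 * r * l)%N.
have T12 : T2 = (n + T1)%N by rewrite /column_time /n /T1; ring.
pose B : R := ln p%:R * (r%:R * (expR (- (6 * l%:R)) * (1 + 2 * T2%:R))).
have r1 : 1 < r%:R :> R by rewrite ltr1n.
have p1 : 1 <= p%:R :> R by rewrite ler1n prime_gt0.
have lnp : 0 <= ln (p%:R : R) by rewrite ln_ge0.
have g0 : 0 <= gamma by rewrite invr_ge0 mulr_ge0 // subr_ge0 ltW.
have r2 : 2 <= r%:R :> R by rewrite ler_nat.
have g1 : gamma <= 1 by rewrite invf_le1; lra.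
have B0 : 0 <= B.
  by rewrite !mulr_ge0 ?expR_ge0 ?addr_ge0 ?mulr_ge0 ?ler0n.
have step k : (k < n)%N -> deficit (Qt (k.+1 + T1) (delta y)) <=
    deficit (Qt (k + T1) (delta y)) - gamma * (deficit (Qt (k + T1) (delta y)) - B).
  move=> kn; rewrite addSn; apply: (le_trans (deficit_Qop_column _)).
    exact: (Qit_ge0 _ c0 r_gt1 _ d0).
  rewrite lerD2l lerN2; apply: ler_wpM2l => //; rewrite lerD2l lerN2.
  apply: ler_wpM2l => //; apply: ler_wpM2l; first exact: ltW.
  have -> : \sum_(g | small_support g) Qt (k + T1) (delta y) g = Qt (k + T1) (fun g => (small_support g)%:R) y.
    by rewrite (QitE rs c0) big_mkcond; apply: eq_bigr => g _; case: ifP; rewrite ?mulr1 ?mulr0.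
  apply: (le_trans (small_support_bound R p_prime p_gt2 r_gt1 r_le r_ge y0 _)); first by rewrite leq_addl.
  by rewrite ler_wpM2l ?expR_ge0 // lerD2l ler_wpM2l // ler_nat T12 leq_add2r ltnW.
have := relax_iterate g0 g1 B0 step; rewrite -T12 add0n => /le_trans; apply.
have D0 : deficit (Qt T1 (delta y)) <= r%:R * p%:R.
  apply: (le_trans (deficit_le (Qit_ge0 _ c0 r_gt1 T1 d0))).
  rewrite (sum_Qit rs c0 r_gt1) sum_dirac mulr1 card_ffun card_Fp // card_ord natrX.
  rewrite lnXn ?ltr0n ?prime_gt0 // -[_ *+ _]mulr_natl ler_wpM2l ?ler0n //.
  by have := @ln_le_subr1 R p%:R; rewrite ltr0n prime_gt0 // => /(_ isT); lra.
(* [gamma * n = 48 r l / (16 (r - 1)) >= 3 l] and [expR (- l) <= 1 / r]: an initial deficit at most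
   [r p] falls to at most [p / r^2]. *)
have e1 : (1 - gamma) ^+ n <= expR (- (3 * l%:R)).
  apply: (le_trans (expr_expR_le _ g1)); rewrite ler_expR lerN2.
  rewrite /gamma ler_pdivlMr ?mulr_gt0 ?subr_gt0 // /n !natrM.
  have : 0 <= l%:R :> R by rewrite ler0n.
  lra.
have er := natr_le_expR R r_le.
have el : expR (- l%:R) <= r%:R^-1 :> R by rewrite expRN lef_pV2 ?posrE ?expR_gt0.
have e3 : expR (- (3 * l%:R)) <= (r%:R^-1) ^+ 3 :> R.
  by rewrite -mulrN expRM_natl lerXn2r ?nnegrE ?expR_ge0 ?invr_ge0 ?ler0n.
have e6 : expR (- (6 * l%:R)) <= (r%:R^-1) ^+ 6 :> R.
  by rewrite -mulrN expRM_natl lerXn2r ?nnegrE ?expR_ge0 ?invr_ge0 ?ler0n.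
have lr : l%:R <= r%:R :> R by rewrite ler_nat; move: r_ge; clear; lia.
have TT : T2%:R <= 2232 * (r%:R * r%:R) :> R.
  rewrite /column_time natrM natrM -mulrA ler_wpM2l ?ler0n //; apply: ler_wpM2l => //; exact: ltW.
have lnpp : ln (p%:R : R) <= p%:R.
  by have := @ln_le_subr1 R p%:R; rewrite ltr0n prime_gt0 // => /(_ isT); lra.
have pr : 600 * (600 * p%:R) <= r%:R :> R by rewrite -!natrM ler_nat.
have x1 : (1 - gamma) ^+ n * deficit (Qt T1 (delta y)) <= p%:R / r%:R / r%:R.
  apply: (@le_trans _ _ ((r%:R^-1) ^+ 3 * (r%:R * p%:R))).
    apply: ler_pM => //; [by rewrite exprn_ge0 // subr_ge0|by apply: deficit_ge0; exact: (Qit_ge0 _ c0 r_gt1 _ d0)|exact: le_trans e3].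
  by rewrite le_eqVlt; apply/orP; left; apply/eqP; field; rewrite gt_eqF.
have x2 : B <= 4465 * (p%:R / r%:R / r%:R / r%:R).
  apply: (@le_trans _ _ (p%:R * (r%:R * ((r%:R^-1) ^+ 6 * (4465 * (r%:R * r%:R)))))).
    apply: ler_pM => //.
    apply: ler_wpM2l; first exact: ltW.
    apply: ler_pM => //.
    have : 1 <= r%:R * r%:R :> R by rewrite mulr_ege1 // ltW.
    lra.
  apply: (@le_trans _ _ (4465 * (p%:R / r%:R / r%:R / r%:R))) => //.
  by rewrite le_eqVlt; apply/orP; left; apply/eqP; field; rewrite gt_eqF.
have x3 : p%:R / r%:R / r%:R / r%:R <= p%:R / r%:R / r%:R :> R.
  by rewrite ler_piMr ?invf_le1 ?divr_ge0 ?ler0n // ltW.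
have x4 : p%:R / r%:R / r%:R <= p%:R / r%:R :> R.
  by rewrite ler_piMr ?invf_le1 ?divr_ge0 ?ler0n // ltW.
have x5 : p%:R / r%:R <= (600 * 600)^-1 :> R by rewrite ler_pdivrMr //; lra.
lra.
Qed.

End ColumnMixing.

(** * Probability that a column vanishes on a block *)

Section ColumnVanishing.
Variables (R : realType) (p r l : nat).
Hypothesis p_prime : prime p.
Hypothesis p_gt2 : (2 < p)%N.
Hypothesis r_gt1 : (1 < r)%N.
Hypothesis r_le : (r <= 2 ^ l)%N.
Hypothesis r_ge : (192 * l <= r)%N.
Hypothesis r_gep : (600 * (600 * p) <= r)%N.

Local Notation config := {ffun 'I_r -> 'F_p}.
Implicit Types (y : config).
Local Notation Qt := (Qit (R := R) (r := r) (@column_act p)).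
Local Notation zero := (zero_config p r).
Local Notation delta y := (@dirac_at R r 'F_p y).
Local Notation T2 := (column_time r l).

Let rs := @column_act_resampling R p.
Let c0 := @cardFp_gt0 p p_prime.

Lemma column_l1 y y' : y != zero -> y' != zero ->
  \sum_g `|Qt T2 (delta y) g - Qt T2 (delta y') g| <= 2^-1.
Proof.
have h z : z != zero -> \sum_g `|Qt T2 (delta z) g - #|{: config}|%:R^-1| <= 4^-1.
  move=> z0; have d0 g : 0 <= delta z g by apply: dirac_ge0.
  have s1 : \sum_g Qt T2 (delta z) g = 1 by rewrite (sum_Qit rs c0 r_gt1) sum_dirac.
  apply: (le_trans (l1_le_deficit (Qit_ge0 _ c0 r_gt1 _ d0) s1)).
  have := column_deficit R p_prime p_gt2 r_gt1 r_le r_ge r_gep z0.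
  move: (deficit _) => D; lra.
move=> /h h1 /h h2; apply: (@le_trans _ _ (4^-1 + 4^-1)); last by lra.
apply: (le_trans _ (lerD h1 h2)); rewrite -big_split; apply: ler_sum => g _ /=.
rewrite [X in _ <= _ + X]distrC.
have -> : Qt T2 (delta y) g - Qt T2 (delta y') g = (Qt T2 (delta y) g - #|{: config}|%:R^-1) + (#|{: config}|%:R^-1 - Qt T2 (delta y') g) by ring.
exact: ler_normD.
Qed.

Lemma column_osc k (f : config -> R) d :
  (forall y y', y != zero -> y' != zero -> `|f y - f y'| <= d) ->
  forall y y', y != zero -> y' != zero -> `|Qt (k * T2) f y - Qt (k * T2) f y'| <= d / 2 ^+ k.
Proof.
move=> h; elim: k => [|k IH] y y' y0 y0'; first by rewrite mul0n expr0 divr1; apply: h.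
rewrite mulSn Qit_add exprSr invfM mulrA.
by have := Qit_osc rs c0 r_gt1 (@zero_fix p r) column_l1 IH y0 y0'.
Qed.

Definition vanishes (B : {set 'I_r}) y : bool := [forall j in B, y j == 0].

Lemma card_vanishes B : (#|[set y | vanishes B y]| * p ^ #|B| = p ^ r)%N.
Proof.
have -> : #|[set y | vanishes B y]| = #|pffun_on (0 : 'F_p) (~: B) 'F_p|.
  apply: eq_card => y; rewrite inE /vanishes; apply/forall_inP/pffun_onP.
    move=> h; split=> [|z _]; last by [].
    by apply/fintype.subsetP => j; rewrite !inE; apply: contraNN => /h.
  move=> [/fintype.subsetP h _] j jB; apply/negPn; apply/negP => yj.
  by have := h j; rewrite !inE yj => /(_ isT); rewrite jB.
rewrite card_pffun_on card_Fp // -expnD addnC cardsC card_ord //.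
Qed.

(** The probability from [y] is within [2^-k] of that from any nonzero start. Uniform measure being
    invariant, the mean over all starts is [p^-|B|]; discarding the zero start costs a factor at
    most 2. *)
Lemma vanishes_bound (B : {set 'I_r}) k t y : y != zero -> (k * T2 <= t)%N ->
  Qt t (fun y => (vanishes B y)%:R) y <= 2 / p%:R ^+ #|B| + (2 ^+ k)^-1.
Proof.
move=> y0 kt; set f : config -> R := fun y => _.
have f01 z : 0 <= f z <= 1 by rewrite /f; case: vanishes; rewrite ?ler01 ?lexx.
have osc z z' : z != zero -> z' != zero -> `|Qt t f z - Qt t f z'| <= (2 ^+ k)^-1.
  rewrite -(subnKC kt) Qit_add -[leRHS]mul1r; apply: column_osc => u v _ _.
  have h0 w : 0 <= Qt (t - k * T2) f w by apply: (Qit_ge0 _ c0 r_gt1) => z1; have /andP[] := f01 z1.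
  have h1 w : Qt (t - k * T2) f w <= 1.
    by apply: (Qit_le rs c0 r_gt1) => z1; have /andP[] := f01 z1.
  have := h0 u; have := h0 v; have := h1 u; have := h1 v.
  by rewrite ler_norml => *; lra.
set e := (2 ^+ k)^-1 in osc *.
have n0 : (0 < p ^ r)%N by rewrite expn_gt0 prime_gt0.
have n2 : 2 <= (p ^ r)%:R :> R.
  rewrite ler_nat; apply: (@leq_trans (2 ^ r)); last by rewrite leq_exp2r ?(ltnW r_gt1) // ltnW.
  by rewrite -{1}(expn1 2) leq_exp2l // ltnW.
have P0 : 0 < p%:R ^+ #|B| :> R by rewrite exprn_gt0 // ltr0n prime_gt0.
have s1 : \sum_z Qt t f z = (p ^ r)%:R / p%:R ^+ #|B|.
  rewrite (sum_Qit rs c0 r_gt1) /f -natr_sum -big_mkcond /= sum1_card -(card_vanishes B).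
  by rewrite natrM natrX mulfK ?gt_eqF // cardsE.
have s2 : ((p ^ r)%:R - 1) * (Qt t f y - e) <= \sum_z Qt t f z.
  rewrite (bigD1 zero) //=; apply: (@le_trans _ _ (0 + \sum_(z | z != zero) (Qt t f y - e))).
    rewrite add0r sumr_const cardC1 card_ffun card_Fp // card_ord -[(Qt t f y - e) *+ _]mulr_natl.
    by rewrite -subn1 natrB.
  apply: lerD; first by apply: (Qit_ge0 _ c0 r_gt1) => z1; have /andP[] := f01 z1.
  by apply: ler_sum => z z0; have := osc _ _ y0 z0; rewrite ler_norml => /andP[_]; lra.
rewrite s1 in s2; rewrite -lerBlDr.
have n1 : 0 < (p ^ r)%:R - 1 :> R by lra.
rewrite -(ler_pM2l n1); apply: (le_trans s2).
have -> : ((p ^ r)%:R - 1) * (2 / p%:R ^+ #|B|) = (2 * ((p ^ r)%:R - 1)) / p%:R ^+ #|B| :> R by ring.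
rewrite ler_pM2r ?invr_gt0 //; lra.
Qed.

End ColumnVanishing.

(** * The walk on tuples of the Heisenberg group *)

Lemma card_ord_lt (r L : nat) : (L <= r)%N -> #|[set k : 'I_r | (k < L)%N]| = L.
Proof.
by move=> Lr; rewrite -sum1dep_card (big_ord_narrow Lr) sum_nat_const card_ord muln1.
Qed.

Lemma balanced_blocks (r L : nat) : (L <= r)%N ->
  exists B : 'I_r -> {set 'I_r}, (forall s, #|B s| = L) /\ (forall j, #|[set s | j \in B s]| = L).
Proof.
case: r => [|r] Lr; first by exists (fun=> finset.set0); split; case.
(* Cyclic intervals: subtraction is modular, so every row lies in exactly [L] blocks without [L]
   dividing the number of rows. *)
exists (fun s => [set j : 'I_r.+1 | ((j - s)%R < L)%N]); split => [s|j].
  by rewrite -[RHS](card_ord_lt Lr) -!sum1dep_card [RHS](reindex_inj (subIr s)).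
rewrite -[RHS](card_ord_lt Lr) -!sum1dep_card [RHS](reindex_inj (subrI j)) /=.
by apply: eq_bigl => s; rewrite inE.
Qed.

Section HeisChain.
Variables (R : realType) (p h r : nat) (om : 'M['F_p]_h).
Hypothesis p_prime : prime p.
Hypothesis p_odd : odd p.
Hypothesis h_gt0 : (0 < h)%N.
Hypothesis alt : alternating_form om.
Hypothesis nondeg : nondegenerate_form om.
Hypothesis r_gt1 : (1 < r)%N.

Local Notation conf := {ffun 'I_r -> heis p h}.
Implicit Types (g : conf).
Local Notation act := (heis_act om).
Local Notation Qt := (Qit (R := R) (r := r) act).
Local Notation delta x := (@dirac_at R r (heis p h) x).

Let rs := heis_act_resampling alt R.

Lemma card_heis : #|{: heis p h}| = (p ^ h.+1)%N.
Proof. by rewrite card_prod card_mx card_Fp // mul1n expnSr. Qed.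

Lemma card_heis_gt0 : (0 < #|{: heis p h}|)%N.
Proof. by rewrite card_heis expn_gt0 prime_gt0. Qed.

Let c0 := card_heis_gt0.

Lemma hpowE (t : heis p h) (a : 'F_p) : hpow om t a = (a *: t.1, a * t.2).
Proof.
have iterE n : iter n (hmul om t) (hone p h) = (n%:R *: t.1, n%:R * t.2).
  elim: n => [|n IH]; first by rewrite scale0r mul0r.
  rewrite iterS IH /hmul /= formZr form_alt // !mulr0 addr0 -natr1.
  by rewrite scalerDl scale1r mulrDl mul1r addrC [t.2 + _]addrC.
by rewrite /hpow iterE natr_Zp.
Qed.

Lemma TR_repl i j a g : TR om j i a g = repl act i j true a g.
Proof.
apply/ffunP => k; rewrite !ffunE; case: eqP => // _.
by rewrite /hmul /heis_act hpowE /= formZr; congr (_, _); ring.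
Qed.

Lemma TL_repl i j a g : TL om j i a g = repl act i j false a g.
Proof.
apply/ffunP => k; rewrite !ffunE; case: eqP => // _.
rewrite /hmul /heis_act hpowE /= formZl (form_skew alt) [a *: _ + _]addrC; congr (_, _); ring.
Qed.

Lemma Qhl_Qop g y : Qhl R om g y = Qop act (delta y) g.
Proof.
rewrite /Qhl /Qop /dirac_at eq_sym; congr (_ * (_ + _)).
rewrite /avg_move (sum_moves (fun i j s => avg (repl act i j s) (fun g0 => (y == g0)%:R) g)).
have e i j : \sum_s avg (repl act i j s) (fun g0 => (y == g0)%:R : R) g =
    p%:R^-1 * \sum_(a : 'F_p) ((TR om j i a g == y)%:R + (TL om j i a g == y)%:R).
  rewrite big_bool /= /avg card_Fp // -mulrDr -big_split; congr (_ * _).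
  by apply: eq_bigr => a _ /=; rewrite TR_repl TL_repl ![_ == y]eq_sym.
under [in RHS]eq_bigr do [under eq_bigr do rewrite e; rewrite -mulr_sumr].
rewrite -mulr_sumr mulrA -invfM /PAPRA; congr (_^-1 * _).
by rewrite /nmoves !natrM; ring.
Qed.

(** [kpow] multiplies by the kernel on the right while [Qit] iterates an operator on functions;
    self-adjointness identifies them on Dirac masses. *)
Lemma kpow_Qit t x y : kpow (Qhl R om) t x y = Qt t (delta x) y.
Proof.
elim: t y => [|t IH] y //=.
under eq_bigr do rewrite IH Qhl_Qop.
rewrite -(sum_Qop_mul rs c0) -[RHS](sum_dirac_mul y).
by apply: eq_bigr => z _; rewrite mulrC.
Qed.

Definition functional (u : 'cV['F_p]_h) g : {ffun 'I_r -> 'F_p} := [ffun k => ((g k).1 *m u) 0 0].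

Lemma functional_repl u i j s a g :
  functional u (repl act i j s a g) = repl (@column_act p) i j s a (functional u g).
Proof.
apply/ffunP => k; rewrite !ffunE; case: eqP => // _.
by rewrite /column_act /= mulmxDl -scalemxAl !mxE.
Qed.

(** Moves are additive on the [W] parts, so a functional of the rows is an autonomous column
    walk. *)
Lemma Qit_functional u t (f : {ffun 'I_r -> 'F_p} -> R) g :
  Qt t (fun g => f (functional u g)) g = Qit (@column_act p) t f (functional u g).
Proof.
elim: t g => // t IH g.
change (Qop act (Qt t (fun g => f (functional u g))) g = Qop (@column_act p) (Qit (@column_act p) t f) (functional u g)).
have -> : Qt t (fun g => f (functional u g)) = fun g => Qit (@column_act p) t f (functional u g).
  exact: funext.
rewrite /Qop; congr (_ * (_ + _ * _)); apply: eq_bigr => k _; rewrite /avg_move /avg.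
by congr (_ * _); apply: eq_bigr => a _; rewrite functional_repl.
Qed.

Section Subgroup.
Variable S : {set heis p h}.
Hypothesis sg : is_subgroupb om S.

Lemma hpow_mem t a : t \in S -> hpow om t a \in S.
Proof.
case/and3P: sg => h1 /forall_inP h2 _ tS; rewrite /hpow; elim: (nat_of_ord a) => //= n IH.
by have /forall_inP := h2 t tS; apply.
Qed.

Lemma heis_act_mem s t a x : t \in S -> x \in S -> heis_act om s t a x \in S.
Proof.
case/and3P: sg => _ /forall_inP h2 _ tS xS.
have pS := hpow_mem a tS.
case: s.
  have -> : heis_act om true t a x = hmul om x (hpow om t a).
    by rewrite /hmul /heis_act hpowE /= formZr; congr (_, _); ring.
  by have /forall_inP := h2 x xS; apply.
have -> : heis_act om false t a x = hmul om (hpow om t a) x.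
  by rewrite /hmul /heis_act hpowE /= formZl (form_skew alt) [a *: _ + _]addrC; congr (_, _); ring.
by have /forall_inP := h2 _ pS; apply.
Qed.

End Subgroup.

Lemma heis_actK s t a : cancel (heis_act om s t a) (heis_act om s t (- a)).
Proof.
move=> [w z]; rewrite /heis_act /= -addrA -scalerDl addrN scale0r addr0; congr (_, _).
by rewrite formDl formZl form_alt //; ring.
Qed.

(** A subgroup containing the new tuple still contains [g j], hence recovers [g i] by the move with
    parameter [- a]. *)
Lemma generates_repl i j s a g : j != i -> generatesb om g -> generatesb om (repl act i j s a g).
Proof.
move=> ji /forallP gen; apply/forallP => S; apply/implyP => /andP[sg /forallP hS].
have /implyP := gen S; apply; rewrite sg /=; apply/forallP => k.
have jS : g j \in S by have := hS j; rewrite /repl upd_other.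
have [->|ki] := eqVneq k i; last by have := hS k; rewrite /repl upd_other.
by have := hS i; rewrite /repl upd_at => iS; rewrite -(heis_actK s (g j) a (g i)) heis_act_mem.
Qed.

(** The elements whose [W] part is killed by [u != 0] form a proper subgroup, which cannot contain a
    generating tuple. *)
Lemma functional_neq0 u g : generatesb om g -> u != 0 -> functional u g != zero_config p r.
Proof.
move=> /forallP gen u0; apply/negP => /eqP e.
pose S := [set x : heis p h | x.1 *m u == 0].
have /implyP := gen S; have sg : is_subgroupb om S.
  apply/and3P; split; first by rewrite inE mul0mx.
    apply/forall_inP => x; rewrite inE => /eqP xu; apply/forall_inP => y; rewrite inE => /eqP yu.
    by rewrite inE /= mulmxDl xu yu addr0.
  by apply/forall_inP => x; rewrite !inE /= mulNmx oppr_eq0.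
have gS : [forall i, g i \in S].
  apply/forallP => i; rewrite inE; apply/eqP/matrixP => a b; rewrite !ord1 [RHS]mxE.
  by have /ffunP/(_ i) := e; rewrite !ffunE.
rewrite sg gS => /(_ isT)/eqP ST; case/negP: u0; apply/eqP/matrixP => a b.
have : ((delta_mx 0 a, 0) : heis p h) \in S by rewrite ST inE.
rewrite inE /= => /eqP/matrixP/(_ 0 b); rewrite -rowE !mxE; apply.
Qed.

End HeisChain.

(** * Entropy decay for tuples of the Heisenberg group *)

Section HeisMixing.
Variables (R : realType) (p h r l : nat) (om : 'M['F_p]_h).
Hypothesis p_prime : prime p.
Hypothesis p_odd : odd p.
Hypothesis h_gt0 : (0 < h)%N.
Hypothesis alt : alternating_form om.
Hypothesis nondeg : nondegenerate_form om.
Hypothesis r_gt1 : (1 < r)%N.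
Hypothesis r_le : (r <= 2 ^ l)%N.
Hypothesis r_ge : (192 * l <= r)%N.
Hypothesis r_gep : (600 * (600 * p) <= r)%N.

(** With one row deleted, [h + 4 l] rows remain and [p^-(h + 4 l) <= p^-h r^-4]: enough for a union
    bound over [p^h] functionals and [r] blocks. *)
Let L := (h + 4 * l + 1)%N.
Hypothesis L_le : (L <= r)%N.

Local Notation conf := {ffun 'I_r -> heis p h}.
Implicit Types (g : conf).
Local Notation act := (heis_act om).
Local Notation Qt := (Qit (R := R) (r := r) act).
Local Notation delta x := (@dirac_at R r (heis p h) x).

Let rs := heis_act_resampling alt R.
Let c0 := card_heis_gt0 h p_prime.

Let p_gt2 : (2 < p)%N.
Proof. by move: (prime_gt1 p_prime) p_odd; case: p => // [[|[|[]]]]. Qed.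

Let r0 : 0 < r%:R :> R.
Proof. by rewrite ltr0n ltnW. Qed.

Let p0 : 0 < p%:R :> R.
Proof. by rewrite ltr0n prime_gt0. Qed.

(** Each column time halves the oscillation, and [2^-(p h + 4 l) <= p^-h r^-4]. *)
Definition burn_in := ((p * h + 4 * l) * column_time r l)%N.

Section Blocks.
Variable B : 'I_r -> {set 'I_r}.
Hypothesis B_card : forall s, #|B s| = L.
Hypothesis B_cover : forall j, #|[set s | j \in B s]| = L.

(** Row [i] is deleted from each block to make this a condition on the fibre over coordinate [i]. *)
Definition blocks_span (i : 'I_r) : pred conf :=
  fun g => [forall s, spans (fun j => (j \in B s) && (j != i)) g].

Lemma blocks_span_upd i x g : blocks_span i (upd i x g) = blocks_span i g.
Proof.
rewrite /blocks_span; apply: eq_forallb => s; rewrite /spans; apply: eq_forallb => u.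
congr (_ ==> _); apply: eq_forallb => j; case: (eqVneq j i) => [_|ji]; first by rewrite andbF.
by rewrite upd_other.
Qed.

Lemma blocks_spanPn i g : ~~ blocks_span i g ->
  (1 : R) <= \sum_s \sum_(u : 'cV['F_p]_h | u != 0) (vanishes (B s :\ i) (functional u g))%:R.
Proof.
rewrite negb_forall => /existsP[s]; rewrite negb_forall => /existsP[u].
rewrite negb_imply => /andP[/forallP hu u0].
have v : vanishes (B s :\ i) (functional u g).
  apply/forall_inP => j; rewrite in_setD1 => /andP[ji jB]; have := hu j.
  by rewrite ji jB /= ffunE => /eqP->; rewrite mxE.
rewrite (bigD1 s) //= (bigD1 u) //= v -addrA lerDl addr_ge0 // sumr_ge0 // => s' _.
exact: sumr_ge0.
Qed.

(** Union bound: at most [r p^h] pairs of a block and a functional, each of probability at most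
    [3 / (p^h r^4)]. *)
Lemma blocks_span_prob i x t : generatesb om x -> (burn_in <= t)%N ->
  \sum_(g | ~~ blocks_span i g) Qt t (delta x) g <= 3 / r%:R ^+ 3.
Proof.
move=> xV tb; set mu := Qt t (delta x).
have mu0 g : 0 <= mu g by apply: (Qit_ge0 _ c0 r_gt1) => z; apply: dirac_ge0.
pose P s u := Qit (@column_act p) t (fun y => (vanishes (B s :\ i) y)%:R : R) (functional u x).
have h1 : \sum_(g | ~~ blocks_span i g) mu g <= \sum_s \sum_(u : 'cV['F_p]_h | u != 0) P s u.
  have -> : \sum_s \sum_(u : 'cV['F_p]_h | u != 0) P s u =
     \sum_g mu g * \sum_s \sum_(u : 'cV['F_p]_h | u != 0) (vanishes (B s :\ i) (functional u g))%:R.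
    rewrite [RHS](eq_bigr (fun g => \sum_s \sum_(u : 'cV['F_p]_h | u != 0) mu g * (vanishes (B s :\ i) (functional u g))%:R)) => [|g _]; last first.
      by rewrite mulr_sumr; apply: eq_bigr => s _; rewrite mulr_sumr.
    rewrite [RHS]exchange_big /=; apply: eq_bigr => s _; rewrite [RHS]exchange_big /=; apply: eq_bigr => u _.
    by rewrite /P -(Qit_functional om u t (fun y => (vanishes (B s :\ i) y)%:R : R)) (QitE rs c0).
  rewrite big_mkcond; apply: ler_sum => g _; case: ifP => [/blocks_spanPn hb|_].
    by rewrite -[leLHS]mulr1 ler_wpM2l.
  by rewrite mulr_ge0 // sumr_ge0 // => s _; rewrite sumr_ge0.
pose q : R := p%:R ^+ h * r%:R ^+ 4.
have q0 : 0 < q by rewrite mulr_gt0 // exprn_gt0.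
have r4 : (r ^ 4 <= 2 ^ (4 * l))%N by rewrite mulnC expnM leq_exp2r.
have h2 s u : u != 0 -> P s u <= 3 / q.
  move=> u0; have y0 := functional_neq0 xV u0.
  apply: (le_trans (vanishes_bound R p_prime p_gt2 r_gt1 r_le r_ge r_gep _ y0 tb)).
  have -> : 3 / q = 2 / q + q^-1 by ring.
  apply: lerD.
    rewrite ler_wpM2l // lef_pV2 ?posrE ?exprn_gt0 // /q -!natrX -natrM ler_nat.
    apply: (@leq_trans (p ^ (h + 4 * l))).
      rewrite expnD leq_mul2l; apply/orP; right; apply: (leq_trans r4).
      by rewrite leq_exp2r ?prime_gt1 // muln_gt0 /=; case: l r_le => // /(leq_trans r_gt1).
    rewrite leq_exp2l ?prime_gt1 //; have := cardsD1 i (B s); rewrite B_card /L => e.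
    by rewrite -(leq_add2l 1) add1n -addn1 e leq_add2r leq_b1.
  rewrite lef_pV2 ?posrE ?exprn_gt0 // /q -!natrX -natrM ler_nat expnD leq_mul //.
  by rewrite expnM leq_exp2r // ltnW // ltn_expl.
apply: (le_trans h1).
apply: (@le_trans _ _ (\sum_(s : 'I_r) \sum_(u : 'cV['F_p]_h) 3 / q)).
  apply: ler_sum => s _; rewrite big_mkcond; apply: ler_sum => u _; case: ifP => [/h2//|_].
  by rewrite divr_ge0 // ltW.
rewrite !sumr_const card_ord card_mx card_Fp // muln1 -mulrnA -[(3 / q) *+ _]mulr_natr natrM natrX /q.
rewrite le_eqVlt; apply/orP; left; apply/eqP; field.
by rewrite gt_eqF // expf_neq0 ?gt_eqF.
Qed.

Let gamma : R := (200 * p%:R * L%:R * (r%:R - 1))^-1.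

Let L0 : 0 < L%:R :> R.
Proof. by rewrite ltr0n /L addn1. Qed.

(** Sum the local inequality over the [r] blocks: each row is counted [L] times, so the sum of gains
    over all neighbours dominates [r / (50 p L)] times the deficit. *)
Lemma deficit_Qop_heis (f : conf -> R) : (forall g, 0 <= f g) ->
  deficit (Qop act f) <= deficit f - gamma * (deficit f -
     ln (p ^ h.+1)%:R * (\sum_i \sum_(g | ~~ blocks_span i g) f g)).
Proof.
move=> f0; pose kappa : R := r%:R / (50 * p%:R * L%:R).
have k0 : 0 <= kappa by rewrite divr_ge0 ?mulr_ge0 ?ler0n // ltW.
have loc i g (F : heis p h -> R) : blocks_span i g -> (forall z, 0 <= F z) ->
    kappa * deficit F <= \sum_(j | j != i) \sum_s gain (act s (g j)) F.
  move=> /forallP sp F0; pose G j := \sum_s gain (act s (g j)) F.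
  have -> : \sum_(j | j != i) \sum_s gain (act s (g j)) F = \sum_(j | j != i) G j by [].
  have e : L%:R * \sum_(j | j != i) G j = \sum_s \sum_(j | (j \in B s) && (j != i)) G j.
    rewrite (exchange_big_dep (fun j => j != i)) /=; last by move=> s j _ /andP[].
    rewrite mulr_sumr; apply: eq_bigr => j ji; rewrite ji.
    under eq_bigl do rewrite andbT.
    by rewrite sumr_const -(B_cover j) cardsE mulr_natl.
  have e2 : r%:R * deficit F <= 50 * p%:R * (L%:R * \sum_(j | j != i) G j).
    rewrite e mulr_sumr; have -> : r%:R * deficit F = \sum_(s < r) deficit F.
      by rewrite sumr_const card_ord mulr_natl.
    by apply: ler_sum => s _; apply: (deficit_heis_le p_prime p_odd h_gt0 alt nondeg (sp s)).
  rewrite /kappa mulrAC ler_pdivrMr; last by rewrite !mulr_gt0.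
  by apply: (le_trans e2); rewrite le_eqVlt; apply/orP; left; apply/eqP; ring.
apply: (le_trans (deficit_Qop rs c0 r_gt1 k0 f0 blocks_span_upd loc)).
have r1 : 1 < r%:R :> R by rewrite ltr1n.
have -> : kappa / (2 * nmoves R r) = gamma.
  rewrite /nmoves !natrM natrB 1?ltnW // /gamma /kappa.
  by field; rewrite !gt_eqF // subr_gt0.
by rewrite (card_heis h p_prime).
Qed.

(** Chosen so that [gamma * n >= 3 l]: the initial deficit, at most [2 p r^2], is divided by at
    least [r^3]. *)
Let n := (600 * p * L * r * l)%N.

Lemma heis_deficit x : generatesb om x -> deficit (Qt (n + burn_in) (delta x)) <= 64^-1.
Proof.
move=> xV; have d0 g : 0 <= delta x g by apply: dirac_ge0.
pose D k := deficit (Qt (k + burn_in) (delta x)).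
pose C : R := ln (p ^ h.+1)%:R * (r%:R * (3 / r%:R ^+ 3)).
have r1 : 1 < r%:R :> R by rewrite ltr1n.
have p1 : 1 <= p%:R :> R by rewrite ler1n prime_gt0.
have L1 : 1 <= L%:R :> R by rewrite ler1n /L addn1.
have r2 : 2 <= r%:R :> R by rewrite ler_nat.
have ln0 : 0 <= ln ((p ^ h.+1)%:R : R) by rewrite ln_ge0 // ler1n expn_gt0 prime_gt0.
have g0 : 0 <= gamma.
  by rewrite invr_ge0 !mulr_ge0 ?subr_ge0 // ltW.
have g1 : gamma <= 1.
  rewrite invf_le1; last by rewrite !mulr_gt0 ?subr_gt0.
  have : 1 <= p%:R * L%:R * (r%:R - 1) :> R.
    by rewrite !mulr_ege1 //; lra.
  by rewrite -!mulrA; lra.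
have C0 : 0 <= C by rewrite mulr_ge0 // mulr_ge0 ?divr_ge0 ?exprn_ge0 ?ler0n.
have step k : (k < n)%N -> D k.+1 <= D k - gamma * (D k - C).
  move=> _; rewrite /D addSn; apply: (le_trans (deficit_Qop_heis _)).
    exact: (Qit_ge0 _ c0 r_gt1 _ d0).
  rewrite lerD2l lerN2; apply: ler_wpM2l => //; rewrite lerD2l lerN2; apply: ler_wpM2l => //.
  apply: (@le_trans _ _ (\sum_(i < r) 3 / r%:R ^+ 3)); last first.
    by rewrite sumr_const card_ord -[(3 / r%:R ^+ 3) *+ _]mulr_natl.
  by apply: ler_sum => i _; apply: blocks_span_prob => //; rewrite leq_addl.
apply: (le_trans (relax_iterate g0 g1 C0 step)).
have lnp : ln ((p ^ h.+1)%:R : R) <= 2 * r%:R * p%:R.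
  rewrite natrX lnXn // -[_ *+ _]mulr_natl.
  have hr : h.+1%:R <= 2 * r%:R :> R by rewrite -natrM ler_nat; move: L_le; rewrite /L; clear; lia.
  have lp : ln (p%:R : R) <= p%:R by have := ln_le_subr1 p0; lra.
  by apply: ler_pM => //; rewrite ?ler0n // ln_ge0.
have D0 : D 0%N <= 2 * p%:R * r%:R ^+ 2.
  apply: (le_trans (deficit_le (Qit_ge0 _ c0 r_gt1 (0 + burn_in) d0))).
  rewrite (sum_Qit rs c0 r_gt1) sum_dirac mulr1 card_ffun card_ord (card_heis h p_prime).
  rewrite natrX lnXn ?ltr0n ?expn_gt0 ?prime_gt0 // -[_ *+ _]mulr_natl.
  apply: (@le_trans _ _ (r%:R * (2 * r%:R * p%:R))); first by rewrite ler_wpM2l // ltW.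
  by rewrite le_eqVlt; apply/orP; left; apply/eqP; ring.
have e1 : (1 - gamma) ^+ n <= expR (- (3 * l%:R)).
  apply: (le_trans (expr_expR_le _ g1)); rewrite ler_expR lerN2 /gamma.
  rewrite ler_pdivlMr; last by rewrite !mulr_gt0 ?subr_gt0.
  have : 0 <= p%:R * L%:R * l%:R :> R by rewrite !mulr_ge0 ?ler0n // ltW.
  by rewrite /n !natrM; lra.
have er := natr_le_expR R r_le.
have el : expR (- l%:R) <= r%:R^-1 :> R by rewrite expRN lef_pV2 ?posrE ?expR_gt0.
have e3 : expR (- (3 * l%:R)) <= (r%:R^-1) ^+ 3 :> R.
  by rewrite -mulrN expRM_natl lerXn2r ?nnegrE ?expR_ge0 ?invr_ge0 ?ler0n.
have pr : 600 * (600 * p%:R) <= r%:R :> R by rewrite -!natrM ler_nat.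
have x1 : (1 - gamma) ^+ n * D 0%N <= 2 * (p%:R / r%:R).
  apply: (@le_trans _ _ ((r%:R^-1) ^+ 3 * (2 * p%:R * r%:R ^+ 2))).
    apply: ler_pM => //; first by rewrite exprn_ge0 // subr_ge0.
      by apply: deficit_ge0; exact: (Qit_ge0 _ c0 r_gt1 _ d0).
    exact: le_trans e3.
  by rewrite le_eqVlt; apply/orP; left; apply/eqP; field; rewrite gt_eqF.
have x2 : C <= 6 * (p%:R / r%:R).
  apply: (@le_trans _ _ ((2 * r%:R * p%:R) * (r%:R * (3 / r%:R ^+ 3)))).
    by apply: ler_wpM2r => //; rewrite mulr_ge0 ?divr_ge0 ?exprn_ge0 ?ler0n.
  by rewrite le_eqVlt; apply/orP; left; apply/eqP; field; rewrite gt_eqF.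
have x5 : p%:R / r%:R <= (600 * 600)^-1 :> R by rewrite ler_pdivrMr //; lra.
move: (D 0%N) x1 => D1; lra.
Qed.

End Blocks.
End HeisMixing.

(** * Total variation and the final estimate *)

Section TotalVariation.
Variables (R : realType) (p h r : nat) (om : 'M['F_p]_h).
Hypothesis p_prime : prime p.
Hypothesis alt : alternating_form om.
Hypothesis r_gt1 : (1 < r)%N.

Local Notation conf := {ffun 'I_r -> heis p h}.
Local Notation act := (heis_act om).
Local Notation Qt := (Qit (R := R) (r := r) act).
Local Notation delta x := (@dirac_at R r (heis p h) x).
Local Notation V := (@Vr p h r om).

Let rs := heis_act_resampling alt R.
Let c0 := card_heis_gt0 h p_prime.

(** Moves preserve generation, so the indicator of [V] is subharmonic and its expectation stays 1
    when started in [V]. *)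
Lemma Qit_off_Vr x t : x \in V -> forall y, y \notin V -> Qt t (delta x) y = 0.
Proof.
move=> xV; pose f (y : conf) : R := (y \in V)%:R.
have mono y : f y <= Qop act f y.
  rewrite -[leLHS](Qop_const rs c0 r_gt1 (f y) y) /Qop ler_wpM2l // lerD2l ler_wpM2l //.
    by rewrite invr_ge0 ler0n.
  apply: ler_sum => k dk; rewrite /avg_move /avg ler_wpM2l ?invr_ge0 ?ler0n //.
  apply: ler_sum => a _; rewrite /f; case yV: (y \in V); last exact: ler0n.
  by rewrite inE in yV; rewrite inE generates_repl.
have ft : 1 <= Qt t f x.
  elim: t => [|t IH]; first by rewrite /= /f xV.
  apply: (le_trans IH); rewrite -[t.+1]addn1 Qit_add; apply: (Qit_mono rs c0 r_gt1); exact: mono.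
have mu0 y : 0 <= Qt t (delta x) y by apply: (Qit_ge0 _ c0 r_gt1) => z; apply: dirac_ge0.
have s1 : \sum_y Qt t (delta x) y = 1 by rewrite (sum_Qit rs c0 r_gt1) sum_dirac.
have sV : \sum_(y | y \notin V) Qt t (delta x) y <= 0.
  have : \sum_y Qt t (delta x) y = Qt t f x + \sum_(y | y \notin V) Qt t (delta x) y.
    rewrite (bigID (fun y => y \in V)) /=; congr (_ + _).
    rewrite (QitE rs c0) big_mkcond; apply: eq_bigr => y _; rewrite /f.
    by case: ifP; rewrite ?mulr1 ?mulr0.
  by rewrite s1; move: ft; lra.
have s0 : \sum_(y | y \notin V) Qt t (delta x) y = 0.
  by apply/eqP; rewrite eq_le sV sumr_ge0.
move=> y yV; exact: (psumr_eq0P (fun z _ => mu0 z) s0 yV).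
Qed.

(** The law lives on [V], so its l1 distance to [U] is at least twice the [U]-mass of the
    complement, which is exactly the l1 distance from [U] to the uniform law on [V]. Both distances
    are at most [1/4]. *)
Lemma tv_le_deficit x t : x \in V -> deficit (Qt t (delta x)) <= 64^-1 ->
  tv (kpow (Qhl R om) t x) (unif R V) <= 4^-1.
Proof.
move=> xV dx; pose mu := Qt t (delta x); pose U : R := #|{: conf}|%:R^-1.
have mu0 y : 0 <= mu y by apply: (Qit_ge0 _ c0 r_gt1) => z; apply: dirac_ge0.
have s1 : \sum_y mu y = 1 by rewrite (sum_Qit rs c0 r_gt1) sum_dirac.
have l1 : \sum_y `|mu y - U| <= 4^-1.
  apply: (le_trans (l1_le_deficit mu0 s1)); rewrite -/mu in dx.
  by move: (deficit mu) dx => D; lra.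
have N0 : (0 < #|V|)%N by apply/card_gt0P; exists x.
have NR : 0 < #|V|%:R :> R by rewrite ltr0n.
have M0 : (0 < #|{: conf}|)%N by apply/card_gt0P; exists x.
have MR : 0 < #|{: conf}|%:R :> R by rewrite ltr0n.
have U0 : 0 <= U by rewrite invr_ge0 ltW.
have UN : U <= #|V|%:R^-1 by rewrite lef_pV2 ?posrE // ler_nat max_card.
have sU : \sum_(y in V) U + \sum_(y | y \notin V) U = 1.
  have sT : \sum_(y : conf) U = 1 by rewrite sumr_const -[U *+ _]mulr_natr mulVf ?gt_eqF.
  by rewrite -sT [RHS](bigID (fun y => y \in V)).
have sVU : \sum_(y in V) U = #|V|%:R * U by rewrite sumr_const mulr_natl.
have sV1 : \sum_(y in V) mu y = 1.
  rewrite -s1 [RHS](bigID (fun y => y \in V)) /= [X in _ = _ + X]big1 ?addr0 // => y yV.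
  exact: Qit_off_Vr.
have a1 : 1 - #|V|%:R * U <= \sum_(y in V) `|mu y - U|.
  by rewrite -sVU -sV1 -sumrB; apply: ler_sum => y _; apply: ler_norm.
have a2 : 1 - #|V|%:R * U <= \sum_(y | y \notin V) `|mu y - U|.
  rewrite -sVU -sU addrAC subrr add0r; apply: ler_sum => y yV.
  by rewrite /mu Qit_off_Vr // sub0r normrN ger0_norm.
have a3 : \sum_y `|U - unif R V y| = 2 * (1 - #|V|%:R * U).
  rewrite (bigID (fun y => y \in V)) /=.
  rewrite (eq_bigr (fun=> #|V|%:R^-1 - U)) => [|y yV]; last first.
    by rewrite /unif yV mul1r distrC ger0_norm // subr_ge0.
  rewrite [X in _ + X](eq_bigr (fun=> U)) => [|y /negbTE yV]; last first.
    by rewrite /unif yV mul0r subr0 ger0_norm.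
  rewrite sumrB sVU sumr_const -[_ *+ _]mulr_natr mulVf ?gt_eqF //.
  by have : \sum_(y | y \notin V) U = 1 - #|V|%:R * U; [rewrite -sVU -sU; ring|move=> ->; ring].
have a4 : \sum_y `|mu y - U| = \sum_(y in V) `|mu y - U| + \sum_(y | y \notin V) `|mu y - U|.
  by rewrite (bigID (fun y => y \in V)).
rewrite /tv; apply: (@le_trans _ _ (2^-1 * (\sum_y `|mu y - U| + \sum_y `|U - unif R V y|))).
  rewrite ler_wpM2l // -big_split; apply: ler_sum => y _ /=.
  rewrite (kpow_Qit R p_prime alt) -/mu.
  have -> : mu y - unif R V y = (mu y - U) + (U - unif R V y) by ring.
  exact: ler_normD.
rewrite a3; move: a1 a2; rewrite a4 in l1 *; lra.
Qed.

End TotalVariation.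

(** Since [r > 2^(l - 1)], it suffices that [2 K l <= m^2 <= 2^m * 2^m] for [m = l./2], which holds
    once [l >= 16 K]. *)
Lemma mul_up_log_le (K r : nat) : (2 ^ (16 * K) <= r)%N -> (0 < K)%N ->
  (16 * K <= up_log 2 r)%N /\ (K * up_log 2 r <= r)%N.
Proof.
move=> Kr K0; set l := up_log 2 r.
have Kl : (16 * K <= l)%N by have := leq_up_log 2 Kr; rewrite up_expnK.
split=> //.
have r1 : (1 < r)%N.
  by apply: leq_trans Kr; rewrite -{1}(expn0 2) ltn_exp2l // muln_gt0.
have := @up_log_gtn 2 r isT r1; rewrite -/l => /ltnW; apply: leq_trans.
set m := l./2.
have lE : l = (odd l + (m + m))%N by rewrite addnn odd_double_half.
have [lm lm2] : (l <= 2 * m + 1)%N /\ (m + m.-1 <= l.-1)%N.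
  by move: (odd l) lE => b ->; clear; case: b => /=; lia.
have mK : (8 * K <= m)%N by move: Kl lm; clear; lia.
apply: (@leq_trans (2 ^ (m + m.-1))); last by rewrite leq_exp2l.
have m0 : (0 < m)%N by move: mK K0; clear; lia.
rewrite expnD; have e : (2 ^ m = 2 * 2 ^ m.-1)%N by rewrite -expnS prednK.
have mm : (m < 2 ^ m)%N by apply: ltn_expl.
rewrite -(leq_pmul2l (isT : (0 < 2)%N)) [in leqRHS]mulnCA -e.
apply: (@leq_trans (m * m)); last by rewrite leq_mul // ltnW.
move: mK lm m0; clear; nia.
Qed.

Lemma ln2_ge_half (R : realType) : 2^-1 <= ln (2 : R).
Proof.
have := @ln_le_subr1 R 2^-1; rewrite invr_gt0 ltr0n => /(_ isT).
by rewrite lnV ?posrE //; lra.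
Qed.

Lemma up_log_le_ln (R : realType) (r : nat) : (4 <= up_log 2 r)%N ->
  (up_log 2 r)%:R <= 3 * ln (r%:R : R).
Proof.
move=> l4; set l := up_log 2 r in l4 *.
have r1 : (1 < r)%N by rewrite ltnNge; apply/negP => rl; move: l4; have := up_log_eq0 2 r; rewrite rl orbT -/l => /eqP->.
have : 2 ^+ l.-1 <= r%:R :> R by rewrite -natrX ler_nat ltnW // up_log_gtn.
rewrite -ler_ln ?posrE ?exprn_gt0 ?ltr0n ?(ltnW r1) // lnXn // -[_ *+ _]mulr_natl.
have -> : l.-1%:R = l%:R - 1 :> R by rewrite -subn1 natrB // (leq_trans _ l4).
have l4' : 4 <= l%:R :> R by rewrite ler_nat.
have := ln2_ge_half R.
move=> h1 h2; have : (l%:R - 1) * 2^-1 <= (l%:R - 1) * ln (2 : R) by rewrite ler_wpM2l //; lra.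
lra.
Qed.

Unset Implicit Arguments.

Theorem theorem4p2 (R : realType) (p : nat) (eps : R) :
  prime p -> odd p -> 0 < eps < 1 ->
  exists C : R, exists r0 : nat,
    forall (r m : nat) (om : 'M['F_p]_(2 * m)),
      (r0 <= r)%N -> (1 <= m)%N -> (2 * m)%:R <= eps * r%:R ->
      alternating_form om -> nondegenerate_form om ->
      exists t : nat,
        @is_mixing_time p (2 * m) r R (@Qhl p (2 * m) r R om) (@Vr p (2 * m) r om) t /\
        t%:R <= C * r%:R * ((2 * m)%:R + ln (r%:R : R)) * ln (r%:R : R).
Proof.
move=> p_prime p_odd /andP[eps0 eps1].
have eps1' : 0 < 1 - eps by rewrite subr_gt0.
(* From [K l <= r]: the first term yields [5 l <= (1 - eps) r], hence room for a block of
   [h + 4 l + 1] rows; the second yields [192 l <= r]. *)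
pose K := (Num.bound (5 / (1 - eps)) + 192)%N.
have K5 : 5 <= K%:R * (1 - eps).
  rewrite -ler_pdivrMr //; apply/ltW.
  have := archi_boundP (_ : 0 <= 5 / (1 - eps)); rewrite divr_ge0 ?ltW // => /(_ isT).
  by move=> /lt_le_trans; apply; rewrite ler_nat leq_addr.
(* [108 = 12 * 3 * 3]: the time is at most [12000 p r l (h + l)], and [l <= 3 ln r] is applied to
   both factors. Only the threshold on [r] depends on [eps]. *)
exists (108 * (1000 * p%:R)), (2 ^ (16 * K) + 600 * (600 * p))%N => r m om rr0 m0 hr alt nondeg.
have r_K : (2 ^ (16 * K) <= r)%N by apply: leq_trans rr0; rewrite leq_addr.
have r_p : (600 * (600 * p) <= r)%N by apply: leq_trans rr0; rewrite leq_addl.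
have K0 : (0 < K)%N by rewrite /K addnC.
have [Kl Klr] := mul_up_log_le r_K K0.
set l := up_log 2 r in Kl Klr.
have l192 : (192 * l <= r)%N by apply: leq_trans Klr; rewrite leq_mul2r /K leq_addl orbT.
have l4 : (4 <= l)%N by apply: leq_trans Kl; move: K0; clear; lia.
have r_le : (r <= 2 ^ l)%N by apply: up_logP.
have r1 : (1 < r)%N by move: l192 l4; clear; lia.
have h0 : (0 < 2 * m)%N by rewrite muln_gt0.
move: (2 * m)%N h0 om hr alt nondeg => h h0 om hr alt nondeg.
have r0 : 0 < r%:R :> R by rewrite ltr0n ltnW.
have l4' : 4 <= l%:R :> R by rewrite ler_nat.
have hL : (h + 4 * l + 1 <= r)%N.
  rewrite -(ler_nat R) (natrD _ (h + 4 * l)) (natrD _ h) natrM.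
  have : K%:R * l%:R <= r%:R :> R by rewrite -natrM ler_nat.
  move=> /(ler_wpM2r (ltW eps1')).
  have : 5 * l%:R <= K%:R * (1 - eps) * l%:R by rewrite ler_wpM2r.
  lra.
have [B [B1 B2]] := balanced_blocks hL.
pose T := (600 * p * (h + 4 * l + 1) * r * l + burn_in p h r l)%N.
have mixT : mixed_at (@Qhl p h r R om) (@Vr p h r om) T.
  move=> x xV; apply: tv_le_deficit => //; rewrite inE in xV.
  exact: (heis_deficit R p_prime p_odd h0 alt nondeg r1 r_le l192 r_p hL B1 B2 xV).
have exT : exists t, `[< mixed_at (@Qhl p h r R om) (@Vr p h r om) t >].
  by exists T; apply/asboolP.
(* The mixing time is the least mixed time, which exists because [T] is one and hence is at most
   [T]. *)
case: (ex_minnP exT) => t /asboolP tmix tmin; exists t; split.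
  split=> // s st smix; have := tmin s; rewrite leqNgt st => /(_ _)/negP; case=> //.
  exact/asboolP.
have tT : (t <= T)%N by apply: tmin; apply/asboolP.
have lln := up_log_le_ln R l4; rewrite -/l in lln.
apply: (@le_trans _ _ T%:R); first by rewrite ler_nat.
have p1 : 1 <= p%:R :> R by rewrite ler1n prime_gt0.
set y := ln _ in lln *; set P : R := p%:R in p1 *; set H : R := h%:R.
have H0 : 0 <= H by rewrite ler0n.
have l0 : 0 <= l%:R :> R by lra.
have e1 : T%:R <= 12 * (1000 * P) * (r%:R * l%:R * (H + l%:R)).
  have -> : T%:R = r%:R * l%:R * (600 * P * (H + 4 * l%:R + 1) + (P * H + 4 * l%:R) * 2232).
    rewrite /T /burn_in /column_time (natrD _ (600 * p * _ * _ * _)) (natrM _ (p * h + 4 * l)).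
    by rewrite (natrD _ (p * h)) (natrM _ (600 * p * _ * _)) (natrM _ (600 * p * _)) (natrM _ (600 * p)) (natrD _ (h + 4 * l)) (natrD _ h) !natrM -/P -/H; ring.
  have -> : 12 * (1000 * P) * (r%:R * l%:R * (H + l%:R)) = r%:R * l%:R * (12 * (1000 * P) * (H + l%:R)) by ring.
  apply: ler_wpM2l; first by rewrite mulr_ge0 // ltW.
  have h1 : l%:R <= P * l%:R by rewrite ler_peMl.
  have h2 : 1 * P <= l%:R * P by rewrite ler_wpM2r //; lra.
  have h3 : 0 <= P * H by rewrite mulr_ge0 //; lra.
  lra.
apply: (le_trans e1).
have -> : 108 * (1000 * P) * r%:R * (H + y) * y = 12 * (1000 * P) * (r%:R * (3 * y) * (3 * (H + y))) by ring.
have P0 : 0 <= P by apply: le_trans p1.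
have A0 : 0 <= 12 * (1000 * P).
  by apply: mulr_ge0; [exact: ler0n|apply: mulr_ge0; [exact: ler0n|]].
have y0 : 0 <= y.
  by rewrite /y ln_ge0 // ler1n ltnW.
apply: (ler_wpM2l A0); clear A0 e1; apply: ler_pM.
- exact: mulr_ge0 (ltW r0) l0.
- exact: addr_ge0.
- exact: ler_wpM2l (ltW r0) _ _ lln.
- by move: (l%:R : R) lln => z lln; lra.
Qed.
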